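(* Let $q\ge2$ be an integer, $T=T_q$ the homogeneous tree of degree $q+1$ with the canonical flow measure $\mu(x)=q^{\ell(x)}$, and $\mathcal L$ the flow Laplacian. Let $\varepsilon:T\to\mathbb C$ be bounded with $\sum_{y\in\mathfrak s(x)}\varepsilon(y)=0$ for all $x\in T$, let $\nabla_{\varepsilon}f(x)=\frac1q\sum_{y\in\mathfrak s(x)}\varepsilon(y)f(y)$, and let $\mathcal R_\varepsilon=\nabla_{\varepsilon}\mathcal L^{-1/2}$. If $\varepsilon$ is not identically zero, then the adjoint $\mathcal R_\varepsilon^*$ does not map $H^1(\mu)$ into $L^1(\mu)$; i.e. it is not true that $\mathcal R_\varepsilon^*f\in L^1(\mu)$ for every $f\in H^1(\mu)\cap L^2(\mu)$.
   Context: $T=T_q$ ($q\ge2$ an integer) is the infinite tree in which every vertex has exactly $q+1$ neighbours, identified with its vertex set, with graph distance $d$. Fix a vertex $o$ and an infinite geodesic ray $\omega_*$ emanating from $o$. For $x\in T$ let $x\wedge\omega_*$ be the vertex of $\omega_*$ closest to $x$; the level of $x$ is $\ell(x)=d(o,x\wedge\omega_* )-d(x,x\wedge\omega_* )$. Each $x$ has a unique neighbour $\mathfrak p(x)$ (predecessor) with $\ell(\mathfrak p(x))=\ell(x)+1$; the other $q$ neighbours, of level $\ell(x)-1$, form the set $\mathfrak s(x)$ of successors. Write $x\ge y$ if $d(x,y)=\ell(x)-\ell(y)$. The measure $\mu$ on $T$ is $\mu(\{x\})=\mu(x)=q^{\ell(x)}$. The flow Laplacian is $\mathcal L f(x)=f(x)-\frac{1}{2\sqrt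 q}\sum_{y\sim x}\frac{\mu(y)^{1/2}}{\mu(x)^{1/2}}f(y)$, where $\sim$ denotes adjacency. It equals $\frac12\nabla^*\nabla$, where $\nabla f(x)=f(x)-f(\mathfrak p(x))$. It is bounded, nonnegative, self-adjoint and injective on $L^2(\mu)$; $\mathcal L^{-1/2}$ is defined by the Spectral Theorem. $\mathcal R_\varepsilon$ extends to a bounded operator on $L^2(\mu)$, and $\mathcal R_\varepsilon^*$ is its $L^2(\mu)$-adjoint. An admissible trapezoid is a subset $F\subset T$ which is either a singleton or of the form $F_{h'}^{h''}(x_0)=\{x\in T: x\le x_0,\ \ell(x_0)-h''<\ell(x)\le \ell(x_0)-h'\}$ for some $x_0\in T$ and positive integers $h',h''$ with $2\le h''/h'\le 12$. A $(1,\infty)$-atom is a function $a$ on $T$ supported in an admissible trapezoid $F$, with $\sum_x a(x)\mu(x)=0$ and $\|a\|_\infty\le \mu(F)^{-1}$. $H^1(\mu)$ is the space of $g\in L^1(\mu)$ of the form $g=\sum_j\lambda_ja_j$ with $a_j$ $(1,\infty)$-atoms and $(\lambda_j)\in\ell^1$ complex. *)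

(* Defs.v *)
From HB Require Import structures.
From mathcomp Require Import all_boot all_order all_algebra.
From mathcomp Require Import all_classical all_reals all_analysis.
From mathcomp.real_closed Require Export complex.
Set Implicit Arguments.
Unset Strict Implicit.
Unset Printing Implicit Defensive.
Import Order.TTheory GRing.Theory Num.Theory.
Local Open Scope classical_set_scope.
Local Open Scope ring_scope.
Local Open Scope complex_scope.

Definition is_walk (V : choiceType) (adj : rel V) (x y : V) (n : nat) : Prop :=
  exists p : seq V, [/\ path adj x p, last x p = y & size p = n].

(* Equals 0 by default when x and y are not connected. *)
Definition gdist (V : choiceType) (adj : rel V) (x y : V) : nat :=
  xget 0%N [set n | is_walk adj x y n /\
                    forall m, is_walk adj x y m -> (n <= m)%N].

Record flow_tree (q : nat) := FlowTree {
  vertex :> choiceType;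
  adj : rel vertex;
  adj_sym : symmetric adj;
  adj_irr : irreflexive adj;
  adj_connected : forall x y : vertex, exists n, is_walk adj x y n;
  adj_acyclic : forall c : seq vertex, (2 < size c)%N -> ~ ucycle adj c;
  adj_regular : forall x : vertex, ([set y | adj x y] #= `I_q.+1)%card;
  origin : vertex;
  ray : nat -> vertex;
  ray0 : ray 0 = origin;
  ray_geodesic : forall m n, (m <= n)%N -> gdist adj (ray m) (ray n) = (n - m)%N
}.

Section Tree.
Context (q : nat) (T : flow_tree q).

Definition dist (x y : T) : nat := gdist (@adj q T) x y.

(* The vertex of the ray closest to x. *)
Definition confluent (x : T) : T :=
  xget (origin T) [set y | range (@ray q T) y /\
                           forall n, (dist x y <= dist x (ray T n))%N].

Definition level (x : T) : int :=
  (dist (origin T) (confluent x))%:Z - (dist x (confluent x))%:Z.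

Definition succs (x : T) : set T := [set y | adj x y /\ level y = level x - 1].

(* above x y means x >= y. *)
Definition above (x y : T) : Prop := (dist x y)%:Z = level x - level y.

Definition trapezoid (x0 : T) (h' h'' : nat) : set T :=
  [set x | [/\ above x0 x, level x0 - h''%:Z < level x &
               level x <= level x0 - h'%:Z]].

Definition admissible (F : set T) : Prop :=
  (exists x, F = [set x]) \/
  (exists (x0 : T) (h' h'' : nat),
     [/\ (0 < h')%N, (2 * h' <= h'')%N, (h'' <= 12 * h')%N &
         F = trapezoid x0 h' h'']).

End Tree.

Section Analysis.
Context (R : realType) (q : nat) (T : flow_tree q).
Local Notation C := R[i].
Local Notation normc := ComplexField.Normc.normc.

Implicit Types (f g h a eps : T -> C) (A B : (T -> C) -> (T -> C)).

Definition mu (x : T) : R := q%:R ^ level x.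

Definition mu_set (F : set T) : \bar R := \esum_(x in F) (mu x)%:E.

(* Unordered sums of absolutely summable families, via positive and negative
   parts; meaningless when the family is not absolutely summable. *)
Definition rsum (u : T -> R) : R :=
  fine (\esum_(x in [set: T]) (Num.max (u x) 0)%:E) -
  fine (\esum_(x in [set: T]) (Num.max (- u x) 0)%:E).

Definition integral_mu f : C :=
  rsum (fun x => complex.Re (f x) * mu x) +i*
  rsum (fun x => complex.Im (f x) * mu x).

Definition norm1 f : \bar R :=
  \esum_(x in [set: T]) (normc (f x) * mu x)%:E.

Definition sqnorm2 f : \bar R :=
  \esum_(x in [set: T]) (normc (f x) ^+ 2 * mu x)%:E.

Definition inL1 f : Prop := (norm1 f < +oo)%E.
Definition inL2 f : Prop := (sqnorm2 f < +oo)%E.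

Definition inner f g : C := integral_mu (fun x => f x * (g x)^*).

(* As mu charges every vertex, L^2(mu) consists of genuine functions; operators
   on L^2(mu) are maps on all functions, constrained on L^2(mu) only. *)
Definition linear_on (D : set (T -> C)) A : Prop :=
  forall (c : C) f g, D f -> D g ->
    A (fun x => c * f x + g x) = (fun x => c * A f x + A g x).

Definition bounded_op A : Prop :=
  [/\ (forall f, inL2 f -> inL2 (A f)), linear_on inL2 A &
      exists M : R, forall f, inL2 f ->
        (sqnorm2 (A f) <= (M ^+ 2)%:E * sqnorm2 f)%E].

Definition adjoint_of A B : Prop :=
  bounded_op B /\
  forall f g, inL2 f -> inL2 g -> inner (A f) g = inner f (B g).

Definition laplacian f : T -> C := fun x =>
  f x - ((2 * Num.sqrt q%:R)^-1)%:C *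
    \sum_(y \in [set y | adj x y]) (Num.sqrt (mu y) / Num.sqrt (mu x))%:C * f y.

Definition nabla_eps eps f : T -> C := fun x =>
  q%:R^-1 * \sum_(y \in succs x) eps y * f y.

(* A resolution of the identity of L^2(mu) on the Borel sets of R. Countable
   additivity is encoded by smeas f, the measure B |-> <E(B) f, f>. *)
Record resolution := Resolution {
  proj : set R -> (T -> C) -> (T -> C);
  smeas : (T -> C) -> {measure set (measurableTypeR R) -> \bar R};
  proj_bounded : forall S : set (measurableTypeR R),
    measurable S -> bounded_op (proj S);
  proj_selfadjoint : forall S : set (measurableTypeR R),
    measurable S -> adjoint_of (proj S) (proj S);
  projT : forall f, inL2 f -> proj setT f = f;
  projI : forall S1 S2 : set (measurableTypeR R),
    measurable S1 -> measurable S2 ->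
    forall f, inL2 f -> proj (S1 `&` S2) f = proj S1 (proj S2 f);
  smeasE : forall S : set (measurableTypeR R), measurable S ->
    forall f, inL2 f -> smeas f S = (complex.Re (inner (proj S f) f))%:E
}.

Definition spectral_dom (E : resolution) (phi : R -> R) : set (T -> C) :=
  [set f | inL2 f /\ (\int[smeas E f]_t ((phi t) ^+ 2)%:E < +oo)%E].

(* A is the operator \int phi dE on its natural domain. For linear A, the
   quadratic form determines A by polarization and density of the domain. *)
Definition spectral_integral (E : resolution) (phi : R -> R) A : Prop :=
  [/\ (forall f, spectral_dom E phi f -> inL2 (A f)),
      linear_on (spectral_dom E phi) A &
      forall f, spectral_dom E phi f ->
        inner (A f) f = (fine (\int[smeas E f]_t (phi t)%:E))%:C].

(* E is the spectral resolution of the everywhere defined operator A. *)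
Definition spectral_resolution_of A (E : resolution) : Prop :=
  spectral_dom E id = inL2 /\ spectral_integral E id A.

(* (Num.sqrt t)^-1 is t^(-1/2) for t > 0 and 0 for t <= 0; the latter set is
   negligible for the spectral resolution of an injective nonnegative
   operator. *)
Definition inv_sqrt (t : R) : R := (Num.sqrt t)^-1.

(* A is the bounded extension of nabla_eps o L^(-1/2). *)
Definition riesz_transform eps A : Prop :=
  bounded_op A /\
  exists (E : resolution) (P : (T -> C) -> (T -> C)),
    [/\ spectral_resolution_of laplacian E,
        spectral_integral E inv_sqrt P &
        forall f, spectral_dom E inv_sqrt f -> A f = nabla_eps eps (P f)].

Definition is_atom a : Prop :=
  exists F : set T,
    [/\ admissible F, (forall x, ~ F x -> a x = 0), integral_mu a = 0 &
        forall x, normc (a x) <= (fine (mu_set F))^-1].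

(* The series converges in L^1(mu). *)
Definition inH1 g : Prop :=
  inL1 g /\
  exists (lam : nat -> C) (a : nat -> T -> C),
    [/\ (forall j, is_atom (a j)),
        (\sum_(0 <= j <oo) (normc (lam j))%:E < +oo)%E &
        (fun n : nat => norm1 (fun x => g x - \sum_(0 <= j < n) lam j * a j x))
          @ \oo --> 0%E].

Definition bounded_weight (eps : T -> C) : Prop :=
  exists M : R, forall x, normc (eps x) <= M.

End Analysis.

(* Main.v *)
Require Import Defs.
From HB Require Import structures.
From mathcomp Require Import all_boot all_order all_algebra.
From mathcomp Require Import all_classical all_reals all_analysis.
From mathcomp Require Import measurable_realfun zify ring lra.

(** Write [p] for the predecessor map and [L] for the flow Laplacian. Let [x0] be a
    vertex with a successor where [eps] does not vanish, [z] a sibling of [x0], and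
    [f] the difference of the indicators of [x0] and [z]: siblings lie in a common
    admissible trapezoid, so [f] is a multiple of an atom. Its image under the
    adjoint of the Riesz transform is [L^(-1/2) w] with [w = conj eps * (f o p)], a
    function that lives on a single level and sums to zero over the successors of
    every vertex.

    Below that level, at depth [n], consider the functions [phi n * w (p^n x)]. As
    [q^n] vertices, each lighter by the factor [q^(-n)], sit at that depth under
    each vertex of the support of [w], integrability means that [phi] is summable; and [L] acts on [phi] as the
    Dirichlet Laplacian of the half-line. For the latter the inverse square root of
    the unit mass at the origin decays like [1 / n] only, and is not summable.

    The proof sees this obstruction through resolvents. The exponentials
    [v s = (1 - s)^n w (p^n x)] satisfy [(s^2 + 2 (1 - s) L) (v s) = w]
    ([geometric_resolvent]), they are bounded uniformly in [s], and [<w, v s>] is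
    the constant [|w|^2]. If [L^(-1/2) w] were integrable, its pairing with [v s]
    would be bounded in [s]. In terms of the spectral measure [nu] of [w] and of
    [g t = s^2 + 2 (1 - s) t] this says that [\int 1 / g dnu] does not depend on
    [s], while [\int t^(-1/2) / g dnu] is bounded. The second fact makes
    [t^(-3/2)] integrable, and with it dominated convergence applied to the first
    one forces [w = 0] ([no_spectral_measure]).

    To pass from [L] to [nu] one needs the spectral measures of [w = g(L) u] and of
    [u + w] in terms of that of [u] ([smeas_affine_op_sqr]). This rests on two
    facts: a spectral projection commutes with [L], because the quadratic form of
    [L] is additive along complementary spectral subspaces ([op_cross]); and there
    is no negative spectrum, because the flow condition on the measure makes the
    form of [L] nonnegative ([laplacian_ge0]). *)

Set Implicit Arguments.
Unset Strict Implicit.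
Unset Printing Implicit Defensive.
Import Order.TTheory GRing.Theory Num.Theory.
Import numFieldNormedType.Exports.
Local Open Scope classical_set_scope.
Local Open Scope ring_scope.
Local Open Scope complex_scope.

(** * Integration against a density *)

Section Density.
Context d (X : measurableType d) (R : realType).
Local Open Scope ereal_scope.

Definition density_measure (m : {measure set X -> \bar R}) (k : X -> R)
  (k0 : forall x, (0 <= k x)%R) (mk : measurable_fun setT k) (A : set X) : \bar R :=
  \int[m]_(x in A) (k x)%:E.

Section instance.
Variables (m : {measure set X -> \bar R}) (k : X -> R).
Hypotheses (k0 : forall x, (0 <= k x)%R) (mk : measurable_fun setT k).

Let D := density_measure m k0 mk.

Let D0 : D set0 = 0.
Proof. by rewrite /D /density_measure integral_set0. Qed.

Let D_ge0 A : 0 <= D A.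
Proof. by apply: integral_ge0 => x _; rewrite lee_fin. Qed.

Let D_sigma : semi_sigma_additive D.
Proof.
move=> F mF tF mUF; rewrite /D /density_measure ge0_integral_bigcup//.
- by apply: is_cvg_nneseries => n _ _; exact: D_ge0.
- by apply/measurable_EFinP; apply: measurable_funTS.
- by move=> x _; rewrite lee_fin.
Qed.

HB.instance Definition _ := isMeasure.Build _ _ _ (density_measure m k0 mk)
  D0 D_ge0 D_sigma.
End instance.

Import HBNNSimple.

Lemma integral_density (m : {measure set X -> \bar R}) (k : X -> R)
    (k0 : forall x, (0 <= k x)%R) (mk : measurable_fun setT k)
    (f : X -> \bar R) :
  (forall x, 0 <= f x) -> measurable_fun setT f ->
  \int[density_measure m k0 mk]_x f x = \int[m]_x (f x * (k x)%:E).
Proof.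
move=> f0 mf.
pose h := nnsfun_approx measurableT mf.
have mkE : measurable_fun setT (EFin \o k) by exact/measurable_EFinP.
have -> : \int[density_measure m k0 mk]_x f x =
    lim (\int[density_measure m k0 mk]_x (EFin \o h n) x @[n --> \oo]).
  have fE x : f x = lim ((EFin \o h n) x @[n --> \oo]).
    by apply/esym/cvg_lim => //; exact: cvg_nnsfun_approx.
  under eq_integral => x _ do rewrite fE.
  apply: monotone_convergence => //.
  - by move=> n; apply/measurable_EFinP.
  - by move=> n x _ //=; rewrite lee_fin.
  - by move=> x _ a b ab; rewrite lee_fin; exact/lefP/nd_nnsfun_approx.
have -> : \int[m]_x (f x * (k x)%:E) =
    lim (\int[m]_x ((EFin \o h n) x * (k x)%:E) @[n --> \oo]).
  have fg x : f x * (k x)%:E = lim ((EFin \o h n) x * (k x)%:E @[n --> \oo]).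
    apply/esym/cvg_lim => //; apply: cvgeZr => //.
    exact: cvg_nnsfun_approx.
  under eq_integral => x _ do rewrite fg.
  apply: monotone_convergence => //.
  - move=> n; apply: emeasurable_funM => //; exact/measurable_EFinP.
  - by move=> n x _ /=; rewrite mule_ge0 ?lee_fin.
  - by move=> x _ a b ab/=; rewrite lee_wpmul2r ?lee_fin//; exact/lefP/nd_nnsfun_approx.
(* Both sides are limits along the same simple functions, where the claim
   reduces to indicators. *)
congr (limn _); apply/funext => n.
have indich (r : R) : measurable_fun setT (fun x => (r * \1_(h n @^-1` [set r]) x)%:E).
  by apply/measurable_EFinP; apply: measurable_funM.
transitivity (\int[density_measure m k0 mk]_x
   (\sum_(y \in range (h n)) (y * \1_(h n @^-1` [set y]) x)%:E)).
  by apply: eq_integral => t tE; rewrite /= fimfunE -fsumEFin.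
rewrite ge0_integral_fsum//; last by move=> y x _; exact: nnfun_muleindic_ge0.
transitivity (\int[m]_x
    (\sum_(y \in range (h n)) (y * \1_(h n @^-1` [set y]) x)%:E * (k x)%:E)); last first.
  apply: eq_integral => x xE.
  rewrite -ge0_mule_fsuml; last by move=> y; exact: nnfun_muleindic_ge0.
  by rewrite fsumEFin // -(fimfunE _ x).
rewrite ge0_integral_fsum//; last 2 first.
  - by move=> y; apply: emeasurable_funM => //.
  - by move=> y x _; apply: mule_ge0; [exact: nnfun_muleindic_ge0|rewrite lee_fin].
apply: eq_fsbigr => r rhn.
have r0 : (0 <= r)%R by move: rhn; rewrite inE => -[x _ <-].
under eq_integral => x _ do rewrite EFinM.
rewrite ge0_integralZl//; last first.
  exact/measurable_EFinP.
under [RHS]eq_integral => x _ do rewrite EFinM -muleA.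
rewrite ge0_integralZl//; last 2 first.
- by apply: emeasurable_funM => //; apply/measurable_EFinP.
- by move=> x _; rewrite mule_ge0 ?lee_fin.
rewrite integral_indic// setIT; congr (_ * _).
rewrite /= /density_measure [LHS]integral_mkcond; apply: eq_integral => x _.
rewrite patchE indicE; case: ifP => _; first by rewrite mul1e.
by rewrite mul0e.
Qed.

(** Polarized identities between spectral measures express one measure as a sum
    of two others and of a density; this turns them into identities between
    integrals. *)
Lemma integral_density3 (m1 m2 m3 m : {measure set X -> \bar R}) (k : X -> R) :
  (forall x, (0 <= k x)%R) -> measurable_fun setT k ->
  (forall A, measurable A ->
     m1 A = m2 A + m3 A + \int[m]_(x in A) (k x)%:E) ->
  forall f : X -> \bar R, (forall x, 0 <= f x) -> measurable_fun setT f ->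
  \int[m1]_x f x = \int[m2]_x f x + \int[m3]_x f x + \int[m]_x (f x * (k x)%:E).
Proof.
move=> k0 mk H f f0 mf.
rewrite (eq_measure_integral (measure_add (measure_add m2 m3) (density_measure m k0 mk))); last first.
  move=> A mA _; rewrite H//.
  rewrite -[LHS]/(m2 A + m3 A + density_measure m k0 mk A).
  by rewrite -(measure_addE m2 m3) -measure_addE.
by rewrite !ge0_integral_measure_add// integral_density.
Qed.

End Density.

(** * An impossible measure on the half-line *)

Section ScalarMeasure.
Context (R : realType).
Local Notation X := (measurableTypeR R).

Lemma measurable_funV_ge0 (D : set X) (h : X -> R) : (forall x, 0 <= h x) ->
  measurable_fun D h -> measurable_fun D (fun x => (h x)^-1).
Proof.
move=> h0 mh.
rewrite (_ : (fun x => (h x)^-1) = (@powR R ^~ (-1)) \o h); last first.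
  by apply/funext => x /=; rewrite powR_inv1.
by apply: measurableT_comp.
Qed.

Lemma measurable_inv_sqrt : measurable_fun [set: X] (@inv_sqrt R).
Proof.
rewrite (_ : @inv_sqrt R = (@powR R ^~ (-1)) \o ((@powR R ^~ (2^-1)) \o (fun t => Num.max t 0))); last first.
  apply/funext => x /=; rewrite powR_inv1 ?powR_ge0// powR12_sqrt ?le_max ?lexx ?orbT//.
  rewrite /inv_sqrt; case: (leP x 0) => // x0.
  by rewrite sqrtr0 ler0_sqrtr.
apply: measurableT_comp => //; apply: measurableT_comp => //.
exact: measurable_maxr.
Qed.

Lemma inv_sqrt_ge0 (t : R) : 0 <= inv_sqrt t.
Proof. by rewrite invr_ge0 sqrtr_ge0. Qed.

Lemma inv_sqrt_sqr (t : R) : inv_sqrt t ^+ 2 = (Num.max t 0)^-1.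
Proof.
rewrite /inv_sqrt exprVn; case: (leP t 0) => t0; last by rewrite sqr_sqrtr// ltW.
by rewrite ler0_sqrtr// expr0n/= invr0.
Qed.

(** The symbol of [s^2 + 2 (1 - s) L]. Negative [t] are sent to [0]: a nonnegative
    operator has no spectrum there, and the symbol is then positive on the whole
    line. *)
Definition resolvent_symbol (s t : R) : R := s ^+ 2 + 2 * (1 - s) * Num.max t 0.
Local Notation g := resolvent_symbol.

Lemma resolvent_symbol_gt0 s t : 0 < s < 1 -> 0 < g s t.
Proof.
move=> /andP[s0 s1]; rewrite ltr_pwDl ?exprn_gt0// mulr_ge0 ?le_max ?lexx ?orbT//.
by lra.
Qed.

Lemma measurable_resolvent_symbol s (D : set X) : measurable_fun D (g s).
Proof.
apply: (measurable_funS measurableT) => //.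
apply: measurable_funD => //; apply: measurable_funM => //.
exact: measurable_maxr.
Qed.

Lemma measurable_resolvent_symbolV s (D : set X) : 0 < s < 1 ->
  measurable_fun D (fun t => (g s t)^-1).
Proof.
move=> s01; apply: measurable_funV_ge0; last exact: measurable_resolvent_symbol.
by move=> x; apply/ltW/resolvent_symbol_gt0.
Qed.

Variable nu : {measure set X -> \bar R}.

Local Notation neg := (`]-oo, 0]%classic : set X).
Local Notation pos := (`]0, +oo[%classic : set X).

(** As [s] tends to [0] the symbol tends to [2 t], and it is at most [3 t] as soon
    as [s^2 <= t]. *)
Lemma integral_le_limit (psi : X -> R) (C : R) :
  (forall t, 0 <= psi t) -> measurable_fun setT psi ->
  (forall s, 0 < s < 1 -> (\int[nu]_t (psi t / g s t)%:E <= C%:E)%E) ->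
  (\int[nu]_t (psi t / Num.max t 0)%:E <= (3 * C)%:E)%E.
Proof.
move=> psi0 mpsi H.
pose s n : R := n.+2%:R^-1.
have s01 n : 0 < s n < 1 by rewrite invr_gt0 ltr0n/= invf_lt1 ?ltr0n// ltr1n.
pose F n : set X := `[s n ^+ 2, +oo[%classic.
have mq : measurable_fun setT (fun t : X => (psi t / Num.max t 0)%:E).
  apply/measurable_EFinP; apply: measurable_funM => //.
  apply: measurable_funV_ge0; last exact: measurable_maxr.
  by move=> x; rewrite le_max lexx orbT.
have q0 (t : X) : (0 <= (psi t / Num.max t 0)%:E)%E.
  by rewrite lee_fin divr_ge0 // le_max lexx orbT.
have -> : (\int[nu]_t (psi t / Num.max t 0)%:E =
   \int[nu]_(t in \bigcup_n F n) (psi t / Num.max t 0)%:E)%E.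
  rewrite [RHS]integral_mkcond; apply: eq_integral => t _; rewrite patchE.
  case: ifPn => //; rewrite notin_setE => nF.
  rewrite max_r ?invr0 ?mulr0//; rewrite leNgt; apply/negP => t0; apply: nF.
  have [n _ Hn] := near_infty_natSinv_lt (PosNum t0).
  exists n => //; rewrite /F /= in_itv/= andbT.
  have sn : s n < t.
    apply: le_lt_trans (Hn n (leqnn n)) => /=.
    by rewrite lef_pV2 ?posrE ?ltr0n// ler_nat.
  have /andP[? ?] := s01 n; apply: (le_trans _ (ltW sn)).
  by rewrite expr2 ger_pMr// ltW.
have ndF : nondecreasing_seq F.
  move=> m n mn; rewrite subsetEset /F => t /=; rewrite !in_itv/= !andbT.
  apply: le_trans; rewrite ler_sqr ?nnegrE ?invr_ge0//.
  by rewrite lef_pV2 ?posrE ?ltr0n// ler_nat ltnS.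
have mF n : measurable (F n) by exact: measurable_itv.
have cv := @ge0_nondecreasing_set_cvg_integral _ X R F
  (fun t : X => (psi t / Num.max t 0)%:E) nu ndF mF
  (fun n => measurable_funS measurableT (@subsetT _ _) mq) (fun n x _ => q0 x).
rewrite -(cvg_lim _ cv)//; apply: lime_le.
  by apply/cvg_ex; eexists; exact: cv.
apply: nearW => n.
have mg : measurable_fun setT (fun t : X => (psi t / g (s n) t)%:E).
  apply/measurable_EFinP; apply: measurable_funM => //.
  exact: measurable_resolvent_symbolV.
have gpos := fun t => resolvent_symbol_gt0 t (s01 n).
apply: (@le_trans _ _ (\int[nu]_(t in F n) (3%:E * (psi t / g (s n) t)%:E))%E).
  apply: ge0_le_integral => //.
  - exact: measurable_funTS.
  - apply: measurable_funTS; apply: emeasurable_funM => //.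
  - move=> t; rewrite /F /= in_itv/= andbT => Ft.
    have t0 : 0 < t by apply: lt_le_trans Ft; rewrite exprn_gt0//; case/andP: (s01 n).
    rewrite -EFinM lee_fin (max_l (ltW t0)) mulrCA ler_wpM2l//.
    rewrite -[leLHS]mul1r ler_pdivrMr// mulrAC ler_pdivlMr// mul1r.
    rewrite /g (max_l (ltW t0)); have /andP[? ?] := s01 n; nra.
rewrite ge0_integralZl//; last 2 first.
- exact: measurable_funTS.
- by move=> t _; rewrite lee_fin divr_ge0// ltW.
rewrite EFinM lee_wpmul2l//; apply: le_trans (H (s n) (s01 n)).
apply: ge0_subset_integral => //.
by move=> t _; rewrite lee_fin divr_ge0// ltW.
Qed.

(** The symbol equals [s^2] where [t <= 0]; this set has therefore mass at most
    [m s^2], for [s] as small as one likes. *)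
Let posC0 (m : R) : 0 < m ->
  (forall s, 0 < s < 1 -> (\int[nu]_t ((g s t)^-1)%:E = m%:E)%E) ->
  nu neg = 0%E.
Proof.
move=> m0 H; apply/eqP; rewrite eq_le measure_ge0 andbT.
apply/lee_addgt0Pr => e e0; rewrite add0e.
pose s := Num.min (Num.sqrt (e / m)) (2^-1).
have s0 : 0 < s by rewrite lt_min sqrtr_gt0 divr_gt0//= invr_gt0.
have s01 : 0 < s < 1.
  by rewrite s0 /= /s gt_min (invf_lt1 (_ : 0 < 2)) ?ltr1n ?orbT.
have sm : s ^+ 2 * m <= e.
  have se : Num.sqrt (e / m) ^+ 2 = e / m by rewrite sqr_sqrtr ?divr_ge0 ?ltW.
  rewrite -ler_pdivlMr// -se ler_sqr ?nnegrE ?sqrtr_ge0 ?(ltW s0)//.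
  by rewrite /s ge_min lexx.
have gpos := fun t => resolvent_symbol_gt0 t s01.
apply: (@le_trans _ _ ((s ^+ 2)%:E * \int[nu]_t ((g s t)^-1)%:E)%E); last first.
  by rewrite H// -EFinM lee_fin.
have mg : measurable_fun setT (fun t : X => ((g s t)^-1)%:E).
  by apply/measurable_EFinP; exact: measurable_resolvent_symbolV.
have s20 : 0 <= s ^+ 2 by rewrite sqr_ge0.
rewrite -ge0_integralZl//; last by move=> t _; rewrite lee_fin invr_ge0 ltW.
have mN : measurable neg by exact: measurable_itv.
apply: (@le_trans _ _ (\int[nu]_(t in neg) ((s ^+ 2)%:E * ((g s t)^-1)%:E))%E); last first.
  apply: ge0_subset_integral => //.
  - by apply: emeasurable_funM.
  - by move=> t _; rewrite -EFinM lee_fin mulr_ge0// invr_ge0 ltW.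
rewrite (_ : (\int[nu]_(t in _) _)%E = (\int[nu]_(t in neg) cst 1%:E t)%E).
  by rewrite integral_cst// mul1e.
apply: eq_integral => t; rewrite inE/= in_itv/= => t0.
by rewrite -EFinM /g max_r// mulr0 addr0 divff// expf_neq0// gt_eqF.
Qed.

Let integral_pos (m : R) (f : X -> R) : 0 < m ->
  (forall s, 0 < s < 1 -> (\int[nu]_t ((g s t)^-1)%:E = m%:E)%E) ->
  (forall t, 0 <= f t) -> measurable_fun setT f ->
  (\int[nu]_t (f t)%:E = \int[nu]_(t in pos) (f t)%:E)%E.
Proof.
move=> m0 H f0 mf.
have mN : measurable neg by exact: measurable_itv.
have mP : measurable pos by exact: measurable_itv.
rewrite (_ : [set: _] = neg `|` pos); last first.
  apply/seteqP; split => // t _ /=; rewrite !in_itv/= andbT.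
  by case: (leP t 0) => ?; [left|right].
rewrite ge0_integral_setU//; last 3 first.
- by apply/measurable_EFinP; exact: measurable_funTS.
- by move=> t _; rewrite lee_fin.
- apply/disj_setPS => t [] /=; rewrite !in_itv/= andbT => t0 t1.
  by move: (lt_le_trans t1 t0); rewrite ltxx.
have -> : (\int[nu]_(t in neg) (f t)%:E = 0)%E; last by rewrite add0e.
apply: null_set_integral => //; last exact: posC0 H.
by apply/measurable_EFinP; exact: measurable_funTS.
Qed.

(** Write [g] and [g'] for the symbols at [s] and [s / 2]. Subtracting the first
    hypothesis at the two parameters gives
    [\int 2 t / (g g') = \int (s + s / 2) / (g g')], and the sum of these two
    integrals is at least [\int 1 / g' = m]. So [m] is at most twice the second
    one. Its integrand tends to [0] at every [t > 0] and, as [s sqrt t <= g] and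
    [t <= g'] for small [s], is dominated by a multiple of [t^(-3/2)], which the second
    hypothesis makes integrable. *)
Lemma no_spectral_measure (m C : R) : 0 < m ->
  (forall s, 0 < s < 1 -> (\int[nu]_t ((g s t)^-1)%:E = m%:E)%E) ->
  (forall s, 0 < s < 1 -> (\int[nu]_t (inv_sqrt t / g s t)%:E <= C%:E)%E) ->
  False.
Proof.
move=> m0 H1 H2.
have mP : measurable pos by exact: measurable_itv.
pose h (t : X) := inv_sqrt t / Num.max t 0.
have tp0 (t : X) : 0 <= Num.max t 0 by rewrite le_max lexx orbT.
have h0 t : 0 <= h t by rewrite divr_ge0 ?inv_sqrt_ge0.
have mh : measurable_fun setT h.
  apply: measurable_funM; first exact: measurable_inv_sqrt.
  by apply: measurable_funV_ge0 => //; exact: measurable_maxr.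
have Ih := integral_le_limit inv_sqrt_ge0 measurable_inv_sqrt H2.
have ih : nu.-integrable pos (fun t => ((3 / 2) * h t)%:E).
  apply: (@integrableS _ _ _ nu setT) => //; apply/integrableP; split.
    by apply/measurable_EFinP; exact: measurable_funM.
  have -> : (\int[nu]_t `|((3 / 2) * h t)%:E| = \int[nu]_t ((3 / 2)%:E * (h t)%:E))%E.
    by apply: eq_integral => t _; rewrite -EFinM gee0_abs// lee_fin mulr_ge0.
  rewrite ge0_integralZl//; last 2 first.
  - exact/measurable_EFinP.
  - by move=> t _; rewrite lee_fin.
  apply: (@le_lt_trans _ _ ((3 / 2)%:E * (3 * C)%:E)%E); last by rewrite -EFinM ltry.
  by rewrite lee_wpmul2l// lee_fin.
pose s n : R := n.+2%:R^-1.
have s12 n : 0 < s n <= 2^-1.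
  by rewrite invr_gt0 ltr0n/= lef_pV2 ?posrE ?ltr0n// ler_nat.
have s01 n : 0 < s n < 1 by have /andP[] := s12 n; lra.
have s'01 n : 0 < s n / 2 < 1 by have /andP[] := s12 n; lra.
pose f n (t : X) := (s n + s n / 2) / (g (s n) t * g (s n / 2) t).
have gp n t := resolvent_symbol_gt0 t (s01 n).
have gp' n t := resolvent_symbol_gt0 t (s'01 n).
have mgg n (D : set X) : measurable_fun D (fun t : X => (g (s n) t * g (s n / 2) t)^-1).
  apply: measurable_funV_ge0 => [t|]; first by rewrite mulr_ge0 ?ltW.
  by apply: measurable_funM; exact: measurable_resolvent_symbol.
have mf n (D : set X) : measurable_fun D (f n) by exact: measurable_funM.
have f0 n t : 0 <= f n t.
  by rewrite divr_ge0// ?mulr_ge0 ?ltW//; have /andP[] := s01 n; lra.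
have gt n t : t \in pos -> t <= g (s n) t /\ t <= g (s n / 2) t.
  rewrite inE/= in_itv/= andbT => t0; rewrite /g (max_l (ltW t0)).
  by have /andP[? ?] := s12 n; split; nra.
have f_le n t : t \in pos -> f n t <= (3 / 2) * h t.
  move=> tP; have [gt1 gt2] := gt n t tP.
  move: tP; rewrite inE/= in_itv/= andbT => t0.
  have /andP[sn0 sn2] := s12 n.
  have r0 : 0 < Num.sqrt t by rewrite sqrtr_gt0.
  have tE : t = Num.sqrt t ^+ 2 by rewrite sqr_sqrtr// ltW.
  have -> : (3 / 2) * h t = (3 / 2 * s n) / ((s n * Num.sqrt t) * t).
    rewrite /h /inv_sqrt (max_l (ltW t0)).
    by field; rewrite !gt_eqF.
  rewrite /f (_ : s n + s n / 2 = 3 / 2 * s n); last by field.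
  rewrite ler_wpM2l//; first by rewrite mulr_ge0// ltW.
  rewrite lef_pV2 ?posrE ?mulr_gt0//.
  apply: ler_pM => //; rewrite ?mulr_ge0 ?ltW//.
  rewrite /g (max_l (ltW t0)) {2}tE.
  have := sqr_ge0 (s n - Num.sqrt t); nra.
(* On the positive half-line only: at [t = 0] the integrands blow up. *)
have F_cvg : (\int[nu]_(t in pos) (f n t)%:E)%E @[n --> \oo] --> 0%E.
  rewrite -(@integral0 _ _ _ nu pos).
  have := @dominated_convergence _ _ _ nu pos mP (fun n t => (f n t)%:E) (cst 0%E)
    (fun t => ((3 / 2) * h t)%:E).
  case => //.
  - by move=> n; exact/measurable_EFinP.
  - apply: aeW => t tP; apply: cvg_EFin; first by apply: nearW.
    have t0 : 0 < t by move: tP; rewrite /= in_itv/= andbT.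
    apply: (@squeeze_cvgr _ _ _ _ (cst 0) (fun n => harmonic n * (3 / 2 / (t * t)))).
    + apply: nearW => n; rewrite f0/= /f.
      have [gt1 gt2] := gt n t (mem_set tP).
      have /andP[sn0 sn2] := s12 n.
      rewrite (_ : s n + s n / 2 = s n * (3 / 2)); last by field.
      have gg0 : 0 < g (s n) t * g (s n / 2) t by rewrite mulr_gt0.
      rewrite -mulrA; apply: ler_pM; [exact: ltW| | |].
      * by rewrite mulr_ge0// invr_ge0 ltW.
      * by rewrite lef_pV2 ?posrE ?ltr0n// ler_nat.
      * rewrite ler_pM2l// lef_pV2 ?posrE ?mulr_gt0//.
        by apply: ler_pM => //; exact: ltW.
    + exact: cvg_cst.
    + rewrite -[X in _ --> X](mul0r (3 / 2 / (t * t))); apply: cvgMl.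
      exact: cvg_harmonic.
  - apply: aeW => t n tP; rewrite gee0_abs ?lee_fin//; apply: f_le.
    by rewrite inE.
have key n : (m%:E <= 2%:E * \int[nu]_(t in pos) (f n t)%:E)%E.
  have /andP[sn0 sn2] := s12 n.
  pose s' := s n / 2.
  have s'0 : 0 < s' by rewrite divr_gt0.
  have mV r : 0 < r < 1 -> measurable_fun pos (fun t => ((g r t)^-1)%:E).
    by move=> r01; apply/measurable_EFinP; exact: measurable_resolvent_symbolV.
  have H r : 0 < r < 1 -> (\int[nu]_(t in pos) ((g r t)^-1)%:E = m%:E)%E.
    move=> r01; rewrite -(H1 r r01) -(integral_pos m0 H1)//.
      by move=> t; rewrite invr_ge0 ltW// resolvent_symbol_gt0.
    exact: measurable_resolvent_symbolV.
  pose b (t : X) := s' * (2 * Num.max t 0) / (g (s n) t * g s' t).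
  have b0 t : 0 <= b t by rewrite !mulr_ge0 ?invr_ge0// ?mulr_ge0// ?ltW// gp'.
  have mb : measurable_fun pos b.
    apply: measurable_funM => //; apply: measurable_funM => //.
    by apply: measurable_funM => //; exact: measurable_maxr.
  have sf0 t : 0 <= s' * f n t by rewrite mulr_ge0// ltW.
  have msf : measurable_fun pos (fun t => (s' * f n t)%:E).
    by apply/measurable_EFinP; exact: measurable_funM.
  have V0 r t : 0 < r < 1 -> (0 <= ((g r t)^-1)%:E)%E.
    by move=> r01; rewrite lee_fin invr_ge0 ltW// resolvent_symbol_gt0.
  have mbE : measurable_fun pos (fun t => (b t)%:E) by exact/measurable_EFinP.
  have bf : (\int[nu]_(t in pos) (b t)%:E = \int[nu]_(t in pos) (s' * f n t)%:E)%E.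
    rewrite -[LHS](@addeK _ m%:E)// -[RHS](@addeK _ m%:E)//; congr (_ - _)%E.
    rewrite -[in LHS](H s' (s'01 n)). rewrite -(H (s n) (s01 n)) -!ge0_integralD//; last first.
    - exact: mV (s'01 n).
    - by move=> t _; exact: V0 (s'01 n).
    - by move=> t _; rewrite lee_fin.
    - exact: mV (s01 n).
    - by move=> t _; exact: V0 (s01 n).
    - by move=> t _; rewrite lee_fin.
    apply: eq_integral => t tP; rewrite -!EFinD ![_ + (_^-1)]addrC; congr (_%:E).
    have := gp n t; have := gp' n t; rewrite -/s' /f -/s' /b.
    rewrite inE/= in_itv/= andbT in tP; move=> g1 g2.
    have E : g (s n) t - g s' t = s' * (s n + s' - 2 * t).
      by rewrite /g (max_l (ltW tP)) /s'; field.
    have E' : g (s n) t = g s' t + s' * (s n + s' - 2 * t) by rewrite -E; ring.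
    have -> : (g s' t)^-1 = g (s n) t / (g (s n) t * g s' t).
      by field; rewrite !gt_eqF.
    have -> : (g (s n) t)^-1 = g s' t / (g (s n) t * g s' t).
      by field; rewrite !gt_eqF.
    rewrite [X in X / _ + _]E' (max_l (ltW tP)) mulrA -!mulrDl; congr (_ / _).
    ring.
  have : (s'%:E * m%:E <= \int[nu]_(t in pos) (s' * f n t)%:E + \int[nu]_(t in pos) (b t)%:E)%E.
    rewrite -(H s' (s'01 n)) -ge0_integralZl//; last 3 first.
    - exact: mV (s'01 n).
    - by move=> t _; exact: V0 (s'01 n).
    - by rewrite lee_fin ltW.
    rewrite -ge0_integralD//; last 2 first.
    - by move=> t _; rewrite lee_fin.
    - by move=> t _; rewrite lee_fin.
    apply: ge0_le_integral => //.
    - by move=> t _; rewrite mule_ge0 ?(V0 _ _ (s'01 n))// lee_fin ltW.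
    - by apply: emeasurable_funM => //; exact: mV (s'01 n).
    - by apply: emeasurable_funD.
    move=> t tP; rewrite -EFinM -EFinD lee_fin /f /b -/s'.
    rewrite /= in_itv/= andbT in tP.
    have := gp n t; have := gp' n t; rewrite -/s' => g1 g2.
    have -> : (g s' t)^-1 = g (s n) t / (g (s n) t * g s' t).
      by field; rewrite !gt_eqF.
    have q0 : 0 <= (g (s n) t * g s' t)^-1 by rewrite invr_ge0 ltW// mulr_gt0.
    have le_g : s' * g (s n) t <= s' * (s n + s' + 2 * Num.max t 0).
      rewrite ler_pM2l// /g (max_l (ltW tP)); rewrite /s' in s'0 *; nra.
    rewrite [leLHS]mulrA; apply: le_trans (ler_wpM2r q0 le_g) _.
    by rewrite le_eqVlt; apply/orP; left; apply/eqP; ring.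
  rewrite bf.
  have -> : (\int[nu]_(t in pos) (s' * f n t)%:E = s'%:E * \int[nu]_(t in pos) (f n t)%:E)%E.
    under eq_integral do rewrite EFinM.
    rewrite ge0_integralZl// ?lee_fin ?ltW//.
    - exact/measurable_EFinP.
    - by move=> t _; rewrite lee_fin.
  have F0 : (0 <= \int[nu]_(t in pos) (f n t)%:E)%E.
    by apply: integral_ge0 => t _; rewrite lee_fin.
  rewrite -ge0_muleDr//.
  by rewrite lee_pmul2l// ?lte_fin// -mule2n mule_natl.
suff : (m%:E <= 0)%E by rewrite lee_fin leNgt m0.
have c2 : (2%:E * \int[nu]_(t in pos) (f n t)%:E)%E @[n --> \oo] --> (2%:E * 0)%E.
  exact: cvgeZl.
rewrite mule0 in c2; rewrite -(cvg_lim _ c2)//; apply: lime_ge.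
  by apply/cvg_ex; eexists; exact: c2.
exact: nearW.
Qed.

End ScalarMeasure.

(** * Absolutely summable families *)

Section Sums.
Context (R : realType) (q : nat) (T : flow_tree q).
Implicit Types (u v : T -> R).

Definition rsummable u : Prop := (\esum_(x in [set: T]) `|u x|%:E < +oo)%E.

Let pospart u := (\esum_(x in [set: T]) (Num.max (u x) 0)%:E)%E.

Let max0 (r : R) : 0 <= Num.max r 0.
Proof. by rewrite le_max lexx orbT. Qed.

Let pos_fin u : rsummable u -> pospart u \is a fin_num.
Proof.
move=> su; rewrite ge0_fin_numE; last by apply: esum_ge0 => x _; rewrite lee_fin.
apply: le_lt_trans su; apply: le_esum => x _.
by rewrite lee_fin ge_max normr_ge0 ler_norm.
Qed.

Lemma rsummableN u : rsummable u -> rsummable (fun x => - u x).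
Proof. by rewrite /rsummable; under [X in _ -> (X < _)%E]eq_esum do rewrite normrN. Qed.

Lemma le_rsummable u v : (forall x, `|u x| <= v x) ->
  (\esum_(x in [set: T]) (v x)%:E < +oo)%E -> rsummable u.
Proof. by move=> uv; apply: le_lt_trans; apply: le_esum => x _; rewrite lee_fin. Qed.

Lemma rsummableD u v : rsummable u -> rsummable v -> rsummable (fun x => u x + v x).
Proof.
move=> su sv; apply: (@le_rsummable _ (fun x => `|u x| + `|v x|)) => [x|].
  exact: ler_normD.
under eq_esum do rewrite EFinD.
by rewrite esumD ?lte_add_pinfty// => x _; rewrite lee_fin.
Qed.

Lemma esumZl (c : R) u : 0 <= c -> (forall x, 0 <= u x) ->
  (\esum_(x in [set: T]) (c * u x)%:E = c%:E * \esum_(x in [set: T]) (u x)%:E)%E.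
Proof.
move=> c0 u0; rewrite /esum; have [->|c_neq0] := eqVneq c 0.
  rewrite mul0e; apply/eqP; rewrite eq_le; apply/andP; split.
    apply: ge_ereal_sup => _ [A _ <-].
    by rewrite fsbig1// => x _; rewrite mul0r.
  apply: ereal_sup_ubound; exists set0; first exact: fsets_set0.
  by rewrite fsbig_set0.
have cp : 0 < c by rewrite lt_neqAle eq_sym c_neq0.
rewrite -ereal_sup_pZl//; congr ereal_sup.
rewrite image_comp; apply: eq_imagel => A [finA _] /=.
by rewrite ge0_mule_fsumr//= => x; rewrite lee_fin.
Qed.

Lemma rsummableZ (c : R) u : rsummable u -> rsummable (fun x => c * u x).
Proof.
rewrite /rsummable => su; under eq_esum do rewrite normrM.
rewrite esumZl//; move: su.
have : (0 <= \esum_(x in [set: T]) `|u x|%:E)%E by apply: esum_ge0.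
by case: esum => //= r _ _; rewrite -EFinM ltry.
Qed.

(** Any decomposition into two summable nonnegative families computes the sum,
    not only the one into positive and negative parts; additivity follows. *)
Lemma rsum_split u (a b : T -> R) : (forall x, 0 <= a x) -> (forall x, 0 <= b x) ->
  (\esum_(x in [set: T]) (a x)%:E < +oo)%E ->
  (\esum_(x in [set: T]) (b x)%:E < +oo)%E ->
  (forall x, u x = a x - b x) ->
  rsum u = fine (\esum_(x in [set: T]) (a x)%:E)%E - fine (\esum_(x in [set: T]) (b x)%:E)%E.
Proof.
move=> a0 b0 sa sb uE.
have su : rsummable u.
  apply: (@le_rsummable _ (fun x => a x + b x)) => [x|].
    by rewrite uE (le_trans (ler_normB _ _))// !ger0_norm.
  under eq_esum do rewrite EFinD.
  by rewrite esumD ?lte_add_pinfty// => x _; rewrite lee_fin.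
have fa : (\esum_(x in [set: T]) (a x)%:E)%E \is a fin_num.
  by rewrite ge0_fin_numE//; apply: esum_ge0 => x _; rewrite lee_fin.
have fb : (\esum_(x in [set: T]) (b x)%:E)%E \is a fin_num.
  by rewrite ge0_fin_numE//; apply: esum_ge0 => x _; rewrite lee_fin.
have fp := pos_fin su; have fn := pos_fin (rsummableN su).
rewrite /rsum -/(pospart u) -/(pospart (fun x => - u x)).
have : (pospart u + \esum_(x in [set: T]) (b x)%:E =
        pospart (fun x => (- u x)%R) + \esum_(x in [set: T]) (a x)%:E)%E.
  rewrite /pospart -!esumD//; try by move=> x _; rewrite lee_fin.
  apply: eq_esum => x _; rewrite -!EFinD; congr (_%:E).
  rewrite !uE; case: (leP (a x - b x) 0) => h; case: (leP (- (a x - b x)) 0) => h'; lra.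
move: fp fn fa fb.
case: pospart => // p _; case: pospart => // n _; case: esum => // x _; case: esum => // y _.
by rewrite /= => -[]; lra.
Qed.

Lemma rsum_ge0E u : (forall x, 0 <= u x) ->
  rsum u = fine (\esum_(x in [set: T]) (u x)%:E)%E.
Proof.
move=> u0; rewrite /rsum (eq_esum (b := fun x => (u x)%:E)); last first.
  by move=> x _; rewrite max_l.
rewrite [X in _ - fine X]esum1 ?subr0// => x _.
by rewrite max_r// oppr_le0.
Qed.

Lemma rsumN u : rsum (fun x => - u x) = - rsum u.
Proof.
rewrite /rsum opprB; congr (_ - fine _); apply: eq_esum => x _.
by rewrite opprK.
Qed.

Lemma eq_rsum u v : u =1 v -> rsum u = rsum v.
Proof. by move=> /funext ->. Qed.

Let pos_sum u : rsummable u -> (\esum_(x in [set: T]) (Num.max (u x) 0)%:E < +oo)%E.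
Proof. by move=> /pos_fin; rewrite fin_numE => /andP[_]; rewrite ltey. Qed.

Lemma rsumD u v : rsummable u -> rsummable v ->
  rsum (fun x => u x + v x) = rsum u + rsum v.
Proof.
move=> su sv.
rewrite (@rsum_split _ (fun x => Num.max (u x) 0 + Num.max (v x) 0)
   (fun x => Num.max (- u x) 0 + Num.max (- v x) 0)).
- under eq_esum do rewrite EFinD.
  under [X in _ - fine X]eq_esum do rewrite EFinD.
  rewrite !esumD//; try by move=> x _; rewrite lee_fin.
  rewrite /rsum !fineD//; try exact: pos_fin.
  + lra.
  + exact: pos_fin (rsummableN su).
  + exact: pos_fin (rsummableN sv).
- by move=> x; rewrite addr_ge0.
- by move=> x; rewrite addr_ge0.
- under eq_esum do rewrite EFinD.
  rewrite esumD//; try by move=> x _; rewrite lee_fin.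
  by apply: lte_add_pinfty; exact: pos_sum.
- under eq_esum do rewrite EFinD.
  rewrite esumD//; try by move=> x _; rewrite lee_fin.
  by apply: lte_add_pinfty; apply: pos_sum; exact: rsummableN.
- move=> x; case: (leP (u x) 0) => ?; case: (leP (v x) 0) => ?;
  case: (leP (- u x) 0) => ?; case: (leP (- v x) 0) => ?; lra.
Qed.

Let rsumZ_ge0 (c : R) u : 0 <= c -> rsummable u ->
  rsum (fun x => c * u x) = c * rsum u.
Proof.
move=> c0 su; have c0' x : Num.max (c * x) 0 = c * Num.max x 0.
  by rewrite maxr_pMr// mulr0.
rewrite /rsum; under eq_esum do rewrite c0'.
under [X in _ - fine X]eq_esum do rewrite -mulrN c0'.
rewrite !esumZl// !fineM//; first by rewrite mulrBr.
- exact: pos_fin (rsummableN su).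
- exact: pos_fin.
Qed.

Lemma rsumZ (c : R) u : rsummable u -> rsum (fun x => c * u x) = c * rsum u.
Proof.
move=> su; case: (leP 0 c) => [|c0]; first by move/rsumZ_ge0; exact.
rewrite -[c]opprK; under [X in rsum X]eq_fun do rewrite mulNr.
by rewrite rsumN rsumZ_ge0 ?mulNr// oppr_ge0 ltW.
Qed.

Lemma rsum_lin3 (a b : R) u v w : rsummable u -> rsummable v -> rsummable w ->
  rsum (fun x => a * u x + b * v x + w x) = a * rsum u + b * rsum v + rsum w.
Proof.
move=> su sv sw; have sau := rsummableZ a su; have sbv := rsummableZ b sv.
by rewrite rsumD ?rsumD ?rsumZ//; exact: rsummableD sau sbv.
Qed.

Lemma le_rsum u v : rsummable u -> rsummable v -> (forall x, u x <= v x) ->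
  rsum u <= rsum v.
Proof.
move=> su sv uv; rewrite -subr_ge0 -rsumN -rsumD//; last exact: rsummableN.
rewrite rsum_ge0E => [|x]; last by rewrite subr_ge0.
by apply: fine_ge0; apply: esum_ge0 => x _; rewrite lee_fin subr_ge0.
Qed.

Lemma rsum_le_norm u : rsummable u ->
  `|rsum u| <= fine (\esum_(x in [set: T]) `|u x|%:E)%E.
Proof.
move=> su; rewrite -rsum_ge0E//.
have sa : rsummable (fun x => `|u x|).
  by rewrite /rsummable; under eq_esum do rewrite normr_id.
rewrite ler_norml; apply/andP; split.
  rewrite lerNl -rsumN; apply: le_rsum => //; first exact: rsummableN.
  by move=> x; rewrite -normrN ler_norm.
by apply: le_rsum => // x; rewrite ler_norm.
Qed.

Lemma rsum_fin (A : set T) u : finite_set A -> (forall x, ~ A x -> u x = 0) ->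
  rsum u = \sum_(x \in A) u x.
Proof.
move=> finA uA.
have E (w : T -> R) : (forall x, 0 <= w x) -> (forall x, ~ A x -> w x = 0) ->
    (\esum_(x in [set: T]) (w x)%:E = (\sum_(x \in A) w x)%:E)%E.
  move=> w0 wA; rewrite -fsumEFin// -esum_fset//; last by move=> x _; rewrite lee_fin.
  rewrite [RHS]esum_mkcond; apply: eq_esum => x _.
  by case: ifPn => //; rewrite notin_setE => /wA ->.
rewrite /rsum !E//=; last 2 first.
- by move=> x /uA ->; rewrite oppr0 maxxx.
- by move=> x /uA ->; rewrite maxxx.
rewrite !fsbig_finite//= -sumrB; apply: eq_bigr => x _.
by case: (leP (u x) 0) => ?; case: (leP (- u x) 0) => ?; lra.
Qed.

Lemma rsummable_fin (A : set T) u : finite_set A -> (forall x, ~ A x -> u x = 0) ->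
  rsummable u.
Proof.
move=> finA uA; rewrite /rsummable.
rewrite (_ : (\esum_(x in _) _)%E = (\esum_(x in A) `|u x|%:E)%E).
  by rewrite esum_fset// fsumEFin// ltry.
rewrite [RHS]esum_mkcond; apply: eq_esum => x _.
by case: ifPn => //; rewrite notin_setE => /uA ->; rewrite normr0.
Qed.

End Sums.

(** * The Hilbert space of square summable functions *)

Section HilbertSpace.
Context (R : realType) (q : nat) (hq : (2 <= q)%N) (T : flow_tree q).
Local Notation C := R[i].
Local Notation normc := ComplexField.Normc.normc.
Local Notation Re := complex.Re.
Local Notation Im := complex.Im.
Implicit Types (f g h : T -> C).

Lemma mu_gt0 (x : T) : 0 < mu R x.
Proof. by rewrite exprz_gt0// ltr0n; apply: leq_trans hq. Qed.

Lemma normc_ge0 (z : C) : 0 <= normc z.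
Proof. by case: z => a b; rewrite sqrtr_ge0. Qed.

Lemma sqr_normc (z : C) : normc z ^+ 2 = Re z ^+ 2 + Im z ^+ 2.
Proof. by case: z => a b /=; rewrite sqr_sqrtr// addr_ge0 ?sqr_ge0. Qed.

Lemma Re_le_normc (z : C) : `|Re z| <= normc z.
Proof.
rewrite -(ler_sqr (_ : _ \is Num.nneg)) ?nnegrE ?normc_ge0// sqr_normc.
by rewrite real_normK ?num_real// lerDl sqr_ge0.
Qed.

Lemma Im_le_normc (z : C) : `|Im z| <= normc z.
Proof.
rewrite -(ler_sqr (_ : _ \is Num.nneg)) ?nnegrE ?normc_ge0// sqr_normc.
by rewrite real_normK ?num_real// lerDr sqr_ge0.
Qed.

Lemma normc_eq0 (z : C) : normc z = 0 -> z = 0.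
Proof. exact: ComplexField.Normc.eq0_normc. Qed.

Lemma normc_conj (z : C) : normc (conjc z) = normc z.
Proof. by case: z => a b /=; rewrite sqrrN. Qed.

Lemma complexP (x y : C) : Re x = Re y -> Im x = Im y -> x = y.
Proof. by case: x y => [a b] [c d] /= -> ->. Qed.

Lemma cReM (x y : C) : Re (x * y) = Re x * Re y - Im x * Im y.
Proof. by case: x y => [a b] [c d]. Qed.

Lemma cImM (x y : C) : Im (x * y) = Re x * Im y + Im x * Re y.
Proof. by case: x y => [a b] [c d]. Qed.

Lemma cReD (x y : C) : Re (x + y) = Re x + Re y.
Proof. by case: x y => [a b] [c d]. Qed.

Lemma cImD (x y : C) : Im (x + y) = Im x + Im y.
Proof. by case: x y => [a b] [c d]. Qed.

Lemma cReN (x : C) : Re (- x) = - Re x.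
Proof. by case: x. Qed.

Lemma conjcD (x y : C) : conjc (x + y) = conjc x + conjc y.
Proof. by case: x y => [a b] [c d]; apply: complexP => //=; rewrite opprD. Qed.

Lemma conjcM (x y : C) : conjc (x * y) = conjc x * conjc y.
Proof. by case: x y => [a b] [c d]; apply: complexP => /=; ring. Qed.

Lemma normcD2 (x y : C) : normc (x + y) ^+ 2 <= 2 * (normc x ^+ 2 + normc y ^+ 2).
Proof.
rewrite !sqr_normc cReD cImD.
have := sqr_ge0 (Re x - Re y); have := sqr_ge0 (Im x - Im y); nra.
Qed.

Lemma normcM_le (x y : C) : normc (x * y) <= normc x ^+ 2 + normc y ^+ 2.
Proof.
rewrite ComplexField.Normc.normcM.
have := sqr_ge0 (normc x - normc y); have := normc_ge0 x; have := normc_ge0 y; nra.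
Qed.

Lemma inL1_Re f : inL1 f -> rsummable (fun x => Re (f x) * mu R x).
Proof.
move=> f1; apply: le_rsummable f1 => x.
by rewrite normrM [`|mu R x|]gtr0_norm ?mu_gt0// ler_wpM2r ?Re_le_normc// ltW// mu_gt0.
Qed.

Lemma inL1_Im f : inL1 f -> rsummable (fun x => Im (f x) * mu R x).
Proof.
move=> f1; apply: le_rsummable f1 => x.
by rewrite normrM [`|mu R x|]gtr0_norm ?mu_gt0// ler_wpM2r ?Im_le_normc// ltW// mu_gt0.
Qed.

Lemma integral_mu_lin (c : C) f g : inL1 f -> inL1 g ->
  integral_mu (fun x => c * f x + g x) = c * integral_mu f + integral_mu g.
Proof.
move=> f1 g1; have [fr fi gr gi] :=
  (And4 (inL1_Re f1) (inL1_Im f1) (inL1_Re g1) (inL1_Im g1)).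
apply: complexP.
  rewrite cReD cReM -mulNr -rsum_lin3//.
  by apply: eq_rsum => x; rewrite cReD cReM; ring.
rewrite cImD cImM -rsum_lin3//.
by apply: eq_rsum => x; rewrite cImD cImM; ring.
Qed.

Lemma integral_mu_conj f : integral_mu (fun x => conjc (f x)) = conjc (integral_mu f).
Proof.
apply: complexP => /=; first by apply: eq_rsum => x; case: (f x).
by rewrite -rsumN; apply: eq_rsum => x; case: (f x) => a b /=; rewrite mulNr.
Qed.

Lemma Re_integral_mu_le f : inL1 f ->
  `|Re (integral_mu f)| <= fine (norm1 f).
Proof.
move=> f1; rewrite (le_trans (rsum_le_norm (inL1_Re f1)))//.
have le12 : (\esum_(x in [set: T]) `|Re (f x) * mu R x|%:E <= norm1 f)%E.
  apply: le_esum => x _; rewrite lee_fin normrM [`|mu R x|]gtr0_norm ?mu_gt0//.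
  by rewrite ler_wpM2r ?Re_le_normc// ltW// mu_gt0.
have p : (0 <= \esum_(x in [set: T]) `|Re (f x) * mu R x|%:E)%E by exact: esum_ge0.
rewrite fine_le// ge0_fin_numE//.
- exact: le_lt_trans f1.
- exact: le_trans le12.
Qed.

Lemma inL2_comb (c : C) f g : inL2 f -> inL2 g -> inL2 (fun x => c * f x + g x).
Proof.
move=> f2 g2.
have mu0 := fun x => ltW (mu_gt0 x).
apply: (@le_lt_trans _ _ (\esum_(x in [set: T]) ((2 * normc c ^+ 2) * (normc (f x) ^+ 2 * mu R x) +
   2 * (normc (g x) ^+ 2 * mu R x))%:E)%E).
  apply: le_esum => x _; rewrite lee_fin.
  apply: le_trans (ler_wpM2r (mu0 x) (normcD2 _ _)) _.
  rewrite ComplexField.Normc.normcM exprMn; lra.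
under eq_esum do rewrite EFinD.
have p h x : 0 <= normc (h x) ^+ 2 * mu R x by rewrite mulr_ge0 ?sqr_ge0.
rewrite esumD; last 2 first.
- by move=> x _; rewrite lee_fin mulr_ge0 ?p// mulr_ge0 ?sqr_ge0.
- by move=> x _; rewrite lee_fin mulr_ge0 ?p.
have fin h (r : R) : inL2 h -> 0 <= r ->
    (\esum_(x in [set: T]) (r * (normc (h x) ^+ 2 * mu R x))%:E < +oo)%E.
  rewrite /inL2 => h2 r0; rewrite esumZl//; move: h2; rewrite -/(sqnorm2 h).
  have : (0 <= sqnorm2 h)%E by apply: esum_ge0 => x _; rewrite lee_fin.
  by case: sqnorm2 => //= s _ _; rewrite -EFinM ltry.
by rewrite lte_add_pinfty// fin// mulr_ge0 ?sqr_ge0.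
Qed.

Lemma inL2_0 : inL2 (fun _ : T => 0 : C).
Proof.
rewrite /inL2 /sqnorm2 esum1// => x _.
by rewrite ComplexField.Normc.normc0 expr0n/= mul0r.
Qed.

Lemma inL2D f g : inL2 f -> inL2 g -> inL2 (fun x => f x + g x).
Proof.
move=> f2 g2; rewrite (_ : (fun x => _) = (fun x => 1 * f x + g x)).
  exact: inL2_comb.
by apply/funext => x; rewrite mul1r.
Qed.

Lemma inL2Z (c : C) f : inL2 f -> inL2 (fun x => c * f x).
Proof.
move=> f2; rewrite (_ : (fun x => _) = (fun x => c * f x + 0)).
  by apply: inL2_comb => //; exact: inL2_0.
by apply/funext => x; rewrite addr0.
Qed.

Lemma inL2_mul f g : inL2 f -> inL2 g -> inL1 (fun x => f x * conjc (g x)).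
Proof.
move=> f2 g2; have mu0 := fun x => ltW (mu_gt0 x).
apply: (@le_lt_trans _ _ (sqnorm2 f + sqnorm2 g)%E); last by rewrite lte_add_pinfty.
rewrite -esumD; try by move=> x _; rewrite lee_fin mulr_ge0 ?sqr_ge0.
apply: le_esum => x _; rewrite -EFinD lee_fin -mulrDl ler_wpM2r//.
by rewrite (le_trans (normcM_le _ _))// normc_conj.
Qed.

Lemma inner_comb (c : C) f g h : inL2 f -> inL2 g -> inL2 h ->
  inner (fun x => c * f x + g x) h = c * inner f h + inner g h.
Proof.
move=> f2 g2 h2; rewrite -integral_mu_lin; try exact: inL2_mul.
by congr integral_mu; apply/funext => x; ring.
Qed.

Lemma innerC f g : inner g f = conjc (inner f g).
Proof.
rewrite -integral_mu_conj; congr integral_mu; apply/funext => x.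
by case: (f x) (g x) => [a b] [c d]; apply: complexP => /=; ring.
Qed.

Lemma innerDl f g h : inL2 f -> inL2 g -> inL2 h ->
  inner (fun x => f x + g x) h = inner f h + inner g h.
Proof.
move=> f2 g2 h2; have := inner_comb 1 f2 g2 h2; rewrite mul1r => <-.
by congr (inner _ h); apply/funext => x; rewrite mul1r.
Qed.

Lemma inner0l h : inner (fun _ => 0) h = 0.
Proof.
by apply: complexP; rewrite /inner /integral_mu /= rsum_ge0E => [|x]; rewrite ?mul0r ?mul0r//= ?esum1//
  => x _; rewrite !mul0r.
Qed.

Lemma innerZl (c : C) f h : inL2 f -> inL2 h ->
  inner (fun x => c * f x) h = c * inner f h.
Proof.
move=> f2 h2; have := inner_comb c f2 inL2_0 h2; rewrite inner0l addr0 => <-.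
by congr (inner _ h); apply/funext => x; rewrite addr0.
Qed.

Lemma innerDr f g h : inL2 f -> inL2 g -> inL2 h ->
  inner h (fun x => f x + g x) = inner h f + inner h g.
Proof. by move=> f2 g2 h2; rewrite innerC innerDl// conjcD -!innerC. Qed.

Lemma innerZr (c : C) f h : inL2 f -> inL2 h ->
  inner h (fun x => c * f x) = conjc c * inner h f.
Proof. by move=> f2 h2; rewrite innerC innerZl// conjcM -innerC. Qed.

Lemma sqnorm2E f : inL2 f -> sqnorm2 f = (Re (inner f f))%:E.
Proof.
move=> f2; rewrite /= rsum_ge0E => [|x]; last first.
  rewrite mulr_ge0// ?(ltW (mu_gt0 _))//.
  by case: (f x) => a b /=; rewrite mulrN opprK addr_ge0// -expr2 sqr_ge0.
rewrite (eq_esum (b := fun x => (normc (f x) ^+ 2 * mu R x)%:E)) => [|x _]; last first.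
  by congr (_ * _)%:E; rewrite sqr_normc; case: (f x) => a b /=; ring.
rewrite fineK// ge0_fin_numE//; apply: esum_ge0 => x _.
by rewrite lee_fin mulr_ge0 ?sqr_ge0// ltW ?mu_gt0.
Qed.

Lemma inner_ge0 f : inL2 f -> 0 <= Re (inner f f).
Proof.
move=> f2; rewrite -lee_fin -sqnorm2E//; apply: esum_ge0 => x _.
by rewrite lee_fin mulr_ge0 ?sqr_ge0// ltW ?mu_gt0.
Qed.

Lemma inner_eq0 f : inL2 f -> Re (inner f f) = 0 -> f = (fun _ => 0).
Proof.
move=> f2 f0; apply/funext => x; apply: normc_eq0; apply/eqP.
have: ((normc (f x) ^+ 2 * mu R x)%:E <= sqnorm2 f)%E.
  apply: esum_ge; exists [set x]; first by split.
  by rewrite fsbig_set1.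
rewrite sqnorm2E// f0 lee_fin => h.
rewrite -sqrf_eq0 eq_le sqr_ge0 andbT.
by move: h; rewrite pmulr_lle0 ?mu_gt0.
Qed.

End HilbertSpace.

(** * Quadratic forms of linear operators *)

Section LinearOperators.
Context (R : realType) (q : nat) (hq : (2 <= q)%N) (T : flow_tree q).
Local Notation C := R[i].
Local Notation iC := (@Complex R 0 1).
Local Notation Re := complex.Re.
Local Notation Im := complex.Im.
Implicit Types (f g h u w : T -> C) (A : (T -> C) -> (T -> C)).
Local Notation add f g := (fun x => f x + g x).
Local Notation scale c f := (fun x => c * f x).

Variables (D : set (T -> C)) (A : (T -> C) -> (T -> C)).
Hypotheses (linA : linear_on D A)
  (DD : forall f g, D f -> D g -> D (add f g))
  (Di : forall f, D f -> D (scale iC f)).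

Lemma linear_onD f g : D f -> D g -> A (add f g) = add (A f) (A g).
Proof.
move=> Df Dg; have := linA 1 Df Dg.
rewrite (_ : (fun x => 1 * f x + g x) = add f g); last by apply/funext => x; rewrite mul1r.
by move=> ->; apply/funext => x; rewrite mul1r.
Qed.

Lemma linear_onZ c f : D f -> A (scale c f) = scale c (A f).
Proof.
move=> Df; apply/funext => x.
have E (d : C) : A (fun x => d * f x + f x) x = d * A f x + A f x by rewrite linA.
have cE : scale c f = (fun x => (c - 1) * f x + f x) by apply/funext => y; ring.
by rewrite cE E; ring.
Qed.

Hypotheses (DL2 : forall f, D f -> inL2 f) (AL2 : forall f, D f -> inL2 (A f)).

Lemma form_add f g : D f -> D g ->
  inner (A (add f g)) (add f g) =
  inner (A f) f + inner (A g) g + (inner (A f) g + inner (A g) f).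
Proof.
move=> Df Dg; have := linear_onD Df Dg => ->.
have [f2 g2 Af2 Ag2] := And4 (DL2 Df) (DL2 Dg) (AL2 Df) (AL2 Dg).
rewrite (innerDl hq Af2 Ag2 (inL2D hq f2 g2)) !(innerDr hq f2 g2)//.
by ring.
Qed.

(** Comparing the cross terms of [f + g] with those of [i f + g] separates
    [<A f, g>] from [<A g, f>]. *)
Lemma cross_i f g : D f -> D g ->
  inner (A (scale iC f)) g + inner (A g) (scale iC f) =
  iC * (inner (A f) g - inner (A g) f).
Proof.
move=> Df Dg; rewrite (linear_onZ iC Df).
have [f2 g2 Af2 Ag2] := And4 (DL2 Df) (DL2 Dg) (AL2 Df) (AL2 Dg).
rewrite (innerZl hq _ Af2 g2) (innerZr hq _ f2 Ag2).
rewrite (_ : conjc iC = - iC) ?mulrBr ?mulNr//.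
by apply: complexP => /=; rewrite ?oppr0.
Qed.

Hypothesis realA : forall f, D f -> Im (inner (A f) f) = 0.

Lemma form_symmetric f g : D f -> D g ->
  Re (inner (A f) g) = Re (inner (A g) f).
Proof.
move=> Df Dg.
have := form_add (Di Df) Dg; rewrite cross_i// => /(congr1 (@complex.Im R)).
have := realA (DD (Di Df) Dg); have := realA (Di Df); have := realA Dg.
rewrite !cImD cImM cReD cReN => -> -> ->.
rewrite [Re iC]/= [Im iC]/=.
by lra.
Qed.

End LinearOperators.

(** * The spectral projections commute with the operator *)

Section SpectralProjections.
Context (R : realType) (q : nat) (hq : (2 <= q)%N) (T : flow_tree q).
Context (E : resolution R T).
Local Notation C := R[i].
Local Notation iC := (@Complex R 0 1).
Local Notation Re := complex.Re.
Local Notation Im := complex.Im.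
Local Notation X := (measurableTypeR R).
Implicit Types (f g h u w : T -> C) (S B : set X).
Local Notation add f g := (fun x => f x + g x).
Local Notation scale c f := (fun x => c * f x).
Local Notation P := (Defs.proj E).
Local Notation L2 := (@inL2 R q T).

Lemma proj_L2 S f : measurable S -> inL2 f -> inL2 (P S f).
Proof. by move=> mS; case: (proj_bounded E mS) => + _ _; exact. Qed.

Lemma proj_linear S : measurable S -> linear_on L2 (P S).
Proof. by move=> mS; case: (proj_bounded E mS). Qed.

Lemma proj_adj S f g : measurable S -> inL2 f -> inL2 g ->
  inner (P S f) g = inner f (P S g).
Proof. by move=> mS f2 g2; case: (proj_selfadjoint E mS) => _; exact. Qed.

Lemma proj_projI S B f : measurable S -> measurable B -> inL2 f ->
  P S (P B f) = P (S `&` B) f.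
Proof. by move=> mS mB f2; rewrite (projI E mS mB f2). Qed.

Lemma proj_idem S f : measurable S -> inL2 f -> P S (P S f) = P S f.
Proof. by move=> mS f2; rewrite proj_projI// setIid. Qed.

Lemma smeas_proj S B f : measurable S -> measurable B -> inL2 f ->
  smeas E (P S f) B = smeas E f (B `&` S).
Proof.
move=> mS mB f2; have mBS : measurable (B `&` S) by exact: measurableI.
have S2 := proj_L2 mS f2; have BS2 := proj_L2 mB S2.
rewrite (smeasE E mB S2) (smeasE E mBS f2) -(proj_adj mS BS2 f2).
by rewrite (proj_projI mB mS f2) (proj_projI mS mBS f2) setIC -setIA setIid.
Qed.

Lemma smeas_setT f : inL2 f -> smeas E f setT = (Re (inner f f))%:E.
Proof. by move=> f2; rewrite smeasE// projT. Qed.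

Lemma smeas_fin f S : measurable S -> inL2 f -> (smeas E f S < +oo)%E.
Proof. by move=> mS f2; rewrite smeasE// ltry. Qed.

Lemma Re_proj_proj S f : measurable S -> inL2 f ->
  (Re (inner (P S f) (P S f)))%:E = smeas E f S.
Proof. by move=> mS f2; rewrite smeasE// -proj_adj ?proj_idem//; exact: proj_L2. Qed.

Lemma proj_eq0 S f : measurable S -> inL2 f -> smeas E f S = 0%E -> P S f = (fun _ => 0).
Proof.
move=> mS f2; rewrite -Re_proj_proj// => -[/inner_eq0 H]; apply: H => //.
exact: proj_L2.
Qed.

(** The defect of the identity is annihilated by both projections, so its spectral
    measure vanishes. *)
Lemma projC S f : measurable S -> inL2 f -> add (P S f) (P (~` S) f) = f.
Proof.
move=> mS f2; have mC : measurable (~` S) by exact: measurableC.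
have [S2 C2] := conj (proj_L2 mS f2) (proj_L2 mC f2).
pose d := fun x => (-1) * (add (P S f) (P (~` S) f)) x + f x.
have A2 := inL2D hq S2 C2.
have d2 : inL2 d by exact: inL2_comb.
suff : d = (fun _ => 0).
  move=> d0; apply/funext => x; have := congr1 (fun k => k x) d0.
  rewrite /d => /eqP; rewrite mulN1r addrC subr_eq0 => /eqP <-//.
have sum : (smeas E f S + smeas E f (~` S) = smeas E f setT)%E.
  by rewrite -measureU ?setICr// setUv.
have Sd B : measurable B -> P B d = add (scale (-1) (add (P B (P S f)) (P B (P (~` S) f)))) (P B f).
  move=> mB; rewrite /d (proj_linear mB (-1) A2 f2).
  by rewrite (linear_onD (proj_linear mB) S2 C2).
have P0 : P set0 f = (fun _ => 0) by apply: proj_eq0; rewrite ?measure0.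
have dS : P S d = (fun _ => 0).
  rewrite Sd// proj_idem// proj_projI// setICr P0.
  by apply/funext => x; ring.
have dC : P (~` S) d = (fun _ => 0).
  rewrite Sd// proj_idem// proj_projI// setICl P0.
  by apply/funext => x; ring.
apply: inner_eq0 => //.
have s1 : smeas E d S = 0%E by rewrite -Re_proj_proj// dS inner0l.
have s2 : smeas E d (~` S) = 0%E by rewrite -Re_proj_proj// dC inner0l.
have : (smeas E d S + smeas E d (~` S) = smeas E d setT)%E.
  by rewrite -measureU ?setICr// setUv.
by rewrite s1 s2 adde0 smeas_setT// => -[].
Qed.

Variable A : (T -> C) -> (T -> C).
Hypothesis EA : spectral_resolution_of A E.
Hypothesis A_ge0 : forall f, inL2 f -> 0 <= Re (inner (A f) f).

Lemma L2D f g : L2 f -> L2 g -> L2 (add f g). Proof. exact: inL2D. Qed.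

Let L2id f : L2 f -> inL2 f. Proof. by []. Qed.

Lemma L2i f : L2 f -> L2 (scale iC f). Proof. exact: inL2Z. Qed.

Lemma op_L2 f : inL2 f -> inL2 (A f).
Proof. by case: EA => dE [H _ _] f2; apply: H; rewrite dE. Qed.

Lemma op_linear : linear_on L2 A.
Proof. by case: EA => dE []; rewrite dE. Qed.

Lemma op_form f : inL2 f ->
  inner (A f) f = (fine (\int[smeas E f]_t t%:E)%E)%:C.
Proof. by case: EA => dE [_ _ H] f2; apply: H; rewrite dE. Qed.

Lemma op_square f : inL2 f -> (\int[smeas E f]_t (t ^+ 2)%:E < +oo)%E.
Proof.
case: EA => dE _ f2; have : spectral_dom E id f by rewrite dE.
by case.
Qed.

Lemma op_form_real f : inL2 f -> Im (inner (A f) f) = 0.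
Proof. by move=> f2; rewrite op_form. Qed.

Lemma op_symmetric f g : inL2 f -> inL2 g ->
  Re (inner (A f) g) = Re (inner (A g) f).
Proof.
apply: (form_symmetric hq op_linear) => //.
- exact: L2D.
- exact: L2i.
- exact: op_L2.
- exact: op_form_real.
Qed.

Local Notation tp t := (Num.max t 0).
Local Notation neg := (`]-oo, 0[%classic : set X).

Let mneg : measurable neg. Proof. exact: measurable_itv. Qed.

Let mtp : measurable_fun setT (fun t : X => tp t).
Proof. exact: measurable_maxr. Qed.

Let mtn : measurable_fun setT (fun t : X => tp (- t)).
Proof. by apply: measurable_maxr => //; exact: oppr_measurable. Qed.

Let tp_ge0 (t : R) : 0 <= tp t. Proof. by rewrite le_max lexx orbT. Qed.

Let tp_le (t : R) : tp t <= 1 + t ^+ 2.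
Proof. by case: (leP t 0) => _; have := sqr_ge0 (t - 1); have := sqr_ge0 t; nra. Qed.

Let int_fin f : inL2 f -> (\int[smeas E f]_t (1 + t ^+ 2)%:E < +oo)%E.
Proof.
move=> f2; under eq_integral => t _ do rewrite EFinD.
rewrite ge0_integralD//; last 2 first.
- by move=> t _; rewrite lee_fin sqr_ge0.
- exact/measurable_EFinP.
by rewrite integral_cst// mul1e lte_add_pinfty ?op_square// smeas_fin.
Qed.

Lemma int_tp_fin f (s : R -> R) : inL2 f -> measurable_fun setT (s : X -> X) ->
  (forall t, 0 <= s t <= 1 + t ^+ 2) ->
  (\int[smeas E f]_t (s t)%:E)%E \is a fin_num.
Proof.
move=> f2 ms sb; rewrite ge0_fin_numE; last first.
  by apply: integral_ge0 => t _; rewrite lee_fin; case/andP: (sb t).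
apply: le_lt_trans (int_fin f2); apply: ge0_le_integral => //.
- by move=> t _; rewrite lee_fin; case/andP: (sb t).
- exact/measurable_EFinP.
- apply/measurable_EFinP; apply: measurable_funD => //.
- by move=> t _; rewrite lee_fin; case/andP: (sb t).
Qed.

Lemma int_pos_neg f : (\int[smeas E f]_t t%:E =
  \int[smeas E f]_t (tp t)%:E - \int[smeas E f]_t (tp (- t))%:E)%E.
Proof.
rewrite integralE; congr (_ - _)%E; apply: eq_integral => t _.
  by rewrite funeposE -EFin_max.
by rewrite funenegE -EFin_max.
Qed.

(** On the spectral subspace of the negative half-line the form is
    [\int t dE <= 0]; being nonnegative too, it vanishes, and with it the mass. *)
Lemma smeas_neg f : inL2 f -> smeas E f neg = 0%E.
Proof.
move=> f2; pose f' := P neg f.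
have f'2 : inL2 f' by exact: proj_L2.
have f'N : smeas E f' (~` neg) = 0%E.
  by rewrite smeas_proj//; [rewrite setICl measure0|exact: measurableC].
have f'I : smeas E f' neg = smeas E f neg by rewrite smeas_proj// setIid.
have Itp : (\int[smeas E f']_t (tp t)%:E = 0)%E.
  rewrite (ge0_negligible_integral (measurableC mneg))//; last 2 first.
  - exact/measurable_EFinP.
  - by move=> t _; rewrite lee_fin.
  rewrite setTD setCK; apply: integral0_eq => t; rewrite /= in_itv/= => t0.
  by rewrite max_r// ltW.
have fn : (\int[smeas E f']_t (tp (- t))%:E)%E \is a fin_num.
  by apply: int_tp_fin => // t; rewrite tp_ge0/= -(sqrrN t) tp_le.
have I0 : (\int[smeas E f']_t (tp (- t))%:E = 0)%E.
  have := A_ge0 f'2; rewrite op_form//= int_pos_neg Itp add0e.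
  have : (0 <= \int[smeas E f']_t (tp (- t))%:E)%E.
    by apply: integral_ge0 => t _; rewrite lee_fin.
  move: fn; case: (integral _ _ _) => //= r _; rewrite lee_fin => r0 r0'.
  by congr (_%:E); lra.
rewrite -f'I; apply/eqP; rewrite eq_le measure_ge0 andbT.
have : (\int[smeas E f']_t `|(tp (- t))%:E| = 0)%E.
  by rewrite -I0; apply: eq_integral => t _; rewrite gee0_abs// lee_fin.
have mtnE : measurable_fun setT (fun t : X => (tp (- t))%:E) by exact/measurable_EFinP.
move=> /(ae_eq_integral_abs (smeas E f') measurableT mtnE) [N [mN N0 sN]].
rewrite -N0; apply: le_measure; rewrite ?inE//.
move=> t; rewrite /= in_itv/= => t0; apply: sN => /= /(_ I) [].
by rewrite max_l ?oppr_ge0 ?ltW// => /eqP; rewrite oppr_eq0 lt_eqF.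
Qed.

Lemma op_form_pos f : inL2 f ->
  (\int[smeas E f]_t (tp t)%:E = (Re (inner (A f) f))%:E)%E.
Proof.
move=> f2; rewrite op_form//= int_pos_neg.
have -> : (\int[smeas E f]_t (tp (- t))%:E = 0)%E.
  rewrite (ge0_negligible_integral mneg)//; last 3 first.
  - exact/measurable_EFinP.
  - by move=> t _; rewrite lee_fin.
  - exact: smeas_neg.
  apply: integral0_eq => t [_]; rewrite /= in_itv/= => /negP; rewrite -leNgt => t0.
  by rewrite max_r// oppr_le0.
rewrite sube0 fineK//; apply: int_tp_fin => // t.
by rewrite tp_ge0 tp_le.
Qed.

(** The form is an integral against the spectral measure, hence additive along
    complementary spectral subspaces: the sum of the two cross terms is zero.
    Multiplying one of the vectors by [i] shows that each of them is. *)
Lemma op_cross S u w : measurable S -> inL2 u -> inL2 w ->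
  inner (A (P S u)) (P (~` S) w) = 0.
Proof.
move=> mS; have mC : measurable (~` S) by exact: measurableC.
move=> u2 w2.
have smC (g f : T -> C) B (B' : set X) : measurable B -> measurable B' ->
    inL2 f -> inL2 g -> B `&` B' = set0 -> inner (P B f) (P B' g) = 0.
  move=> mB mB' f2 g2 BB'; rewrite -(proj_adj mB' (proj_L2 mB f2) g2).
  by rewrite proj_projI// setIC BB' proj_eq0 ?measure0// inner0l.
have split_form f g : inL2 f -> inL2 g ->
    inner (A (P S f)) (P (~` S) g) + inner (A (P (~` S) g)) (P S f) = 0.
  move=> f2 g2; have [Sf2 Cg2] := conj (proj_L2 mS f2) (proj_L2 mC g2).
  have h2 := inL2D hq Sf2 Cg2.
  have mE B : measurable B ->
      smeas E (add (P S f) (P (~` S) g)) B =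
      (smeas E (P S f) B + smeas E (P (~` S) g) B)%E.
    move=> mB; rewrite !smeasE// -EFinD; congr (_%:E).
    rewrite (form_add hq (proj_linear mB) L2id (fun _ => proj_L2 mB)) //.
    rewrite (proj_projI mB mS)// (proj_projI mB mC)//.
    have z1 : inner (P (B `&` S) f) (P (~` S) g) = 0.
      apply: smC => //; first exact: measurableI.
      by rewrite -setIA setICr setI0.
    have z2 : inner (P (B `&` ~` S) g) (P S f) = 0.
      apply: smC => //; first exact: measurableI.
      by rewrite -setIA setICl setI0.
    by rewrite z1 z2 !addr0 cReD.
  have := form_add hq op_linear L2id op_L2 Sf2 Cg2.
  have -> : inner (A (add (P S f) (P (~` S) g))) (add (P S f) (P (~` S) g)) =
      inner (A (P S f)) (P S f) + inner (A (P (~` S) g)) (P (~` S) g).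
    apply: complexP; last by rewrite cImD !op_form_real// addr0.
    rewrite cReD.
    have : (\int[smeas E (add (P S f) (P (~` S) g))]_t (tp t)%:E =
       \int[smeas E (P S f)]_t (tp t)%:E + \int[smeas E (P (~` S) g)]_t (tp t)%:E)%E.
      rewrite (eq_measure_integral (measure_add (smeas E (P S f)) (smeas E (P (~` S) g)))); last first.
        by move=> B' mB' _; rewrite mE// -measure_addE.
      rewrite ge0_integral_measure_add//.
        by move=> t _; rewrite lee_fin.
      exact/measurable_EFinP.
    by rewrite !op_form_pos// => -[].
  by rewrite -[LHS]addr0 => /addrI <-.
have H1 := split_form u w u2 w2.
have [Su2 Cw2] := conj (proj_L2 mS u2) (proj_L2 mC w2).
have := split_form (scale iC u) w (L2i u2) w2.
rewrite (linear_onZ (proj_linear mS) iC u2) (cross_i hq op_linear L2id op_L2)//.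
move/eqP; rewrite mulf_eq0 => /orP[/eqP[] /eqP|]; first by rewrite oner_eq0.
rewrite subr_eq0 => /eqP H2; move: H1; rewrite -H2 => /eqP.
by rewrite -mulr2n mulrn_eq0 => /eqP.
Qed.

Lemma op_proj_comm S u : measurable S -> inL2 u -> P S (A (P S u)) = A (P S u).
Proof.
move=> mS u2; have mC : measurable (~` S) by exact: measurableC.
have AS2 : inL2 (A (P S u)) by apply: op_L2; exact: proj_L2.
rewrite -[RHS](projC mS AS2) [P (~` S) _](_ : _ = fun=> 0).
  by apply/funext => x; rewrite addr0.
apply: inner_eq0 => //; first exact: proj_L2.
rewrite proj_adj//; last exact: proj_L2.
by rewrite proj_idem// op_cross.
Qed.

Lemma proj_op S u : measurable S -> inL2 u -> P S (A u) = A (P S u).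
Proof.
move=> mS u2; have mC : measurable (~` S) by exact: measurableC.
have [Su2 Cu2] := conj (proj_L2 mS u2) (proj_L2 mC u2).
rewrite -{1}(projC mS u2) (linear_onD op_linear Su2 Cu2).
rewrite (linear_onD (proj_linear mS) (op_L2 Su2) (op_L2 Cu2)).
rewrite op_proj_comm// -(op_proj_comm mC u2) proj_projI//; last exact: op_L2.
have -> : P (S `&` ~` S) (A (P (~` S) u)) = (fun _ => 0).
  by rewrite setICr; apply: proj_eq0; [by []|exact: op_L2|rewrite measure0].
by apply/funext => x; rewrite addr0.
Qed.

Lemma smeas_op S u : measurable S -> inL2 u ->
  (\int[smeas E u]_(t in S) (tp t)%:E = (Re (inner (P S (A u)) u))%:E)%E.
Proof.
move=> mS u2; have mC : measurable (~` S) by exact: measurableC.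
have Su2 := proj_L2 mS u2.
have -> : inner (P S (A u)) u = inner (A (P S u)) (P S u).
  rewrite -(proj_adj mS)//; last exact: op_L2.
  by rewrite -proj_op// proj_idem//; exact: op_L2.
rewrite -op_form_pos// [RHS](ge0_negligible_integral mC)//; last 3 first.
- exact/measurable_EFinP.
- by move=> t _; rewrite lee_fin.
- by rewrite /= smeas_proj// setICl measure0.
rewrite setTD setCK; apply: eq_measure_integral => B mB BS; apply/esym.
by rewrite smeas_proj// setIidl.
Qed.

End SpectralProjections.

(** * Spectral calculus of affine functions and of the inverse square root *)

Section SpectralCalculus.
Context (R : realType) (q : nat) (hq : (2 <= q)%N) (T : flow_tree q).
Context (E : resolution R T).
Local Notation C := R[i].
Local Notation iC := (@Complex R 0 1).
Local Notation Re := complex.Re.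
Local Notation Im := complex.Im.
Local Notation X := (measurableTypeR R).
Implicit Types (f g h u w : T -> C) (S B : set X).
Local Notation add f g := (fun x => f x + g x).
Local Notation scale c f := (fun x => c * f x).
Local Notation P := (Defs.proj E).
Local Notation L2 := (@inL2 R q T).

Variable A : (T -> C) -> (T -> C).
Hypothesis EA : spectral_resolution_of A E.
Hypothesis A_ge0 : forall f, inL2 f -> 0 <= Re (inner (A f) f).

Lemma Re_innerC f g : Re (inner f g) = Re (inner g f).
Proof. by rewrite innerC; case: inner. Qed.

Lemma Re_inner_comb (a b : R) f g h : inL2 f -> inL2 g -> inL2 h ->
  Re (inner (fun x => a%:C * f x + b%:C * g x) h) =
  a * Re (inner f h) + b * Re (inner g h).
Proof.
move=> f2 g2 h2; rewrite (inner_comb hq a%:C f2 (inL2Z hq b%:C g2) h2).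
rewrite (innerZl hq b%:C g2 h2) cReD !cReM.
by rewrite [Re a%:C]/= [Im a%:C]/= [Re b%:C]/= [Im b%:C]/= !mul0r !subr0.
Qed.

Lemma smeas_add S f g : measurable S -> inL2 f -> inL2 g ->
  (smeas E (add f g) S =
   smeas E f S + smeas E g S + (2 * Re (inner (P S f) g))%:E)%E.
Proof.
move=> mS f2 g2; rewrite !(smeasE E mS)//; last exact: inL2D.
rewrite (form_add hq (proj_linear E mS) (fun h (h2 : L2 h) => h2)
  (fun h => proj_L2 E mS (f := h)) f2 g2) !cReD.
have -> : Re (inner (P S g) f) = Re (inner (P S f) g).
  by rewrite proj_adj// Re_innerC.
by rewrite -!EFinD; congr (_%:E); ring.
Qed.

Section symbol.
Variables (a b : R).
Hypotheses (a0 : 0 <= a) (b0 : 0 <= b).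

Definition affine_op u : T -> C := fun x => a%:C * u x + b%:C * A u x.
Definition affine_symbol (t : R) : R := a + b * Num.max t 0.
Local Notation gA := affine_op.
Local Notation g := affine_symbol.

Let tp_ge0 (t : R) : 0 <= Num.max t 0. Proof. by rewrite le_max lexx orbT. Qed.

Lemma affine_symbol_ge0 t : 0 <= g t.
Proof. by rewrite addr_ge0// mulr_ge0. Qed.

Lemma measurable_affine_symbol : measurable_fun setT (g : X -> X).
Proof. by apply: measurable_funD => //; apply: measurable_funM => //; exact: measurable_maxr. Qed.

Let measurable_EFin_symbol (S : set X) : measurable_fun S (fun t : X => (g t)%:E).
Proof.
by apply: measurable_funTS; apply/measurable_EFinP; exact: measurable_affine_symbol.
Qed.

Lemma affine_op_L2 u : inL2 u -> inL2 (gA u).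
Proof. by move=> u2; apply: inL2_comb => //; apply: inL2Z => //; exact: op_L2 EA _ u2. Qed.

Let gA_linear : linear_on L2 gA.
Proof.
move=> c f h f2 h2; apply/funext => x; rewrite /gA (op_linear EA c f2 h2).
by ring.
Qed.

Let proj_gA S u : measurable S -> inL2 u ->
  P S (gA u) = fun x => a%:C * P S u x + b%:C * P S (A u) x.
Proof.
move=> mS u2; have Au2 := op_L2 EA u2.
rewrite /gA (proj_linear E mS a%:C u2 (inL2Z hq b%:C Au2)).
by rewrite (linear_onZ (proj_linear E mS) b%:C Au2).
Qed.

Lemma proj_affine_op S u : measurable S -> inL2 u -> P S (gA u) = gA (P S u).
Proof. by move=> mS u2; rewrite proj_gA// /gA (proj_op hq EA A_ge0). Qed.

Lemma affine_op_symmetric f h : inL2 f -> inL2 h ->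
  Re (inner (gA f) h) = Re (inner (gA h) f).
Proof.
move=> f2 h2; have [Af2 Ah2] := conj (op_L2 EA f2) (op_L2 EA h2).
rewrite (Re_inner_comb a b f2 Af2 h2) (Re_inner_comb a b h2 Ah2 f2).
by rewrite (op_symmetric hq EA f2 h2) [Re (inner f h)]Re_innerC.
Qed.

Lemma smeas_affine_op S u : measurable S -> inL2 u ->
  (\int[smeas E u]_(t in S) (g t)%:E = (Re (inner (P S (gA u)) u))%:E)%E.
Proof.
move=> mS u2; have Au2 := op_L2 EA u2.
have [Su2 SAu2] := conj (proj_L2 E mS u2) (proj_L2 E mS Au2).
rewrite proj_gA// (Re_inner_comb a b Su2 SAu2 u2).
under eq_integral => t _ do rewrite EFinD EFinM.
have mm : measurable_fun S (fun t : X => (Num.max t 0)%:E).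
  by apply/measurable_EFinP; apply: measurable_funTS; exact: measurable_maxr.
rewrite ge0_integralD//; last 2 first.
- by move=> t _; rewrite -EFinM lee_fin mulr_ge0.
- exact: emeasurable_funM.
rewrite integral_cst// ge0_integralZl//; last by move=> t _; rewrite lee_fin.
by rewrite (smeas_op hq EA A_ge0)// smeasE// -!EFinM -EFinD.
Qed.

Lemma smeas_affine_op_add S u : measurable S -> inL2 u ->
  (smeas E (add u (gA u)) S = smeas E u S + smeas E (gA u) S +
   \int[smeas E u]_(t in S) (2 * g t)%:E)%E.
Proof.
move=> mS u2; have gu2 := affine_op_L2 u2.
rewrite smeas_add//; congr (_ + _)%E.
under eq_integral => t _ do rewrite EFinM.
rewrite ge0_integralZl//; last by move=> t _; rewrite lee_fin affine_symbol_ge0.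
rewrite smeas_affine_op// -EFinM; congr ((_ * _)%:E).
by rewrite proj_adj// Re_innerC.
Qed.

(** Multiplicativity of the calculus, by polarization. With [w = g(A) u], the
    spectral measure of [u + w] is [E_u + E_w + 2 g E_u]. Integrating [g] over [S]
    against it and comparing with the expansion of the form of [g(A)] at [u + w],
    whose cross terms are both [E_w S], leaves [E_w S = \int_S g^2 dE_u]. *)
Lemma smeas_affine_op_sqr S u : measurable S -> inL2 u ->
  (smeas E (gA u) S = \int[smeas E u]_(t in S) (g t ^+ 2)%:E)%E.
Proof.
move=> mS u2; have gu2 := affine_op_L2 u2; set w := gA u in gu2 *.
have uw2 := inL2D hq u2 gu2.
pose B f := P S (gA f).
have BL : linear_on L2 B.
  move=> c f h f2 h2; rewrite /B gA_linear//.
  by rewrite (proj_linear E mS c (affine_op_L2 f2) (affine_op_L2 h2)).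
have B2 f : L2 f -> inL2 (B f).
  by move=> f2; apply: proj_L2 => //; exact: affine_op_L2.
have Bu : Re (inner (B u) w) = Re (inner (P S w) w) by [].
have Bw : Re (inner (B w) u) = Re (inner (P S w) w).
  rewrite /B proj_adj//; last exact: affine_op_L2.
  rewrite affine_op_symmetric//; last exact: proj_L2.
  by rewrite -proj_affine_op.
have form := congr1 (@complex.Re R) (form_add hq BL (fun h (h2 : L2 h) => h2) B2 u2 gu2).
rewrite !cReD Bu Bw in form.
(* [g] cut off outside [S], to integrate over the whole line. *)
pose k (t : X) := (g t * \1_S t)%:E.
have kE (m : {measure set X -> \bar R}) (r : X -> R) : (\int[m]_t (k t * (r t)%:E) =
    \int[m]_(t in S) (g t * r t)%:E)%E.
  rewrite [RHS]integral_mkcond; apply: eq_integral => t _.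
  by rewrite /k patchE indicE; case: ifP => _; rewrite -EFinM ?mulr1// mulr0 mul0r.
have kE1 (m : {measure set X -> \bar R}) : (\int[m]_t k t = \int[m]_(t in S) (g t)%:E)%E.
  rewrite [RHS]integral_mkcond; apply: eq_integral => t _.
  by rewrite /k patchE indicE; case: ifP => _; rewrite ?mulr1// mulr0.
have mk : measurable_fun setT k.
  apply/measurable_EFinP; apply: measurable_funM; first exact: measurable_affine_symbol.
  exact: measurable_indic.
have := @integral_density3 _ X R (smeas E (add u w)) (smeas E u) (smeas E w) (smeas E u)
   (fun t => 2 * g t) _ _ _ k _ mk.
rewrite !kE1 kE !smeas_affine_op// => /(_ _ _ _ _)/= dens.
have {dens} : ((Re (inner (B (add u w)) (add u w)))%:E =
  (Re (inner (B u) u))%:E + (Re (inner (B w) w))%:E +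
  \int[smeas E u]_(t in S) (g t * (2 * g t))%:E)%E.
  apply: dens.
  - by move=> t; rewrite mulr_ge0// affine_symbol_ge0.
  - by apply: measurable_funM => //; exact: measurable_affine_symbol.
  - by move=> D mD; exact: smeas_affine_op_add.
  - by move=> t; rewrite lee_fin mulr_ge0// affine_symbol_ge0.
rewrite form.
have -> : (\int[smeas E u]_(t in S) (g t * (2 * g t))%:E =
   2%:E * \int[smeas E u]_(t in S) (g t ^+ 2)%:E)%E.
  rewrite -ge0_integralZl//.
  - by apply: eq_integral => t _; rewrite -EFinM; congr (_%:E); ring.
  - by apply: measurable_funTS; apply/measurable_EFinP; apply: measurable_funX; exact: measurable_affine_symbol.
  - by move=> t _; rewrite lee_fin sqr_ge0.
rewrite smeasE//; case: (integral _ _ _) => [r| |].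
- rewrite -!EFinM -!EFinD => H; have eqr := EFin_inj H.
  by congr (_%:E); move: eqr => /addrI; lra.
- by rewrite gt0_muley ?lte_fin.
- by rewrite gt0_muleNy ?lte_fin.
Qed.

Lemma integral_affine_op u (f : X -> \bar R) : inL2 u ->
  (forall t, 0 <= f t)%E -> measurable_fun setT f ->
  (\int[smeas E (gA u)]_t f t = \int[smeas E u]_t (f t * (g t ^+ 2)%:E))%E.
Proof.
move=> u2 f0 mf.
have k0 (t : X) : 0 <= g t ^+ 2 by rewrite sqr_ge0.
have mk : measurable_fun setT (fun t : X => g t ^+ 2 : X).
  by apply: measurable_funX; exact: measurable_affine_symbol.
rewrite -(integral_density (smeas E u) k0 mk)//.
by apply: eq_measure_integral => S mS _; rewrite smeas_affine_op_sqr.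
Qed.

Lemma integral_affine_op_add u (f : X -> \bar R) : inL2 u ->
  (forall t, 0 <= f t)%E -> measurable_fun setT f ->
  (\int[smeas E (add u (gA u))]_t f t = \int[smeas E u]_t f t +
    \int[smeas E (gA u)]_t f t + \int[smeas E u]_t (f t * (2 * g t)%:E))%E.
Proof.
move=> u2 f0 mf; apply: integral_density3 => //.
- by move=> t; rewrite mulr_ge0// affine_symbol_ge0.
- by apply: measurable_funM => //; exact: measurable_affine_symbol.
- by move=> D mD; exact: smeas_affine_op_add.
Qed.

(** Both sides are [\int g dE_u]. Keeping [w = g(A) u] fixed and varying [g] gives
    many integrals against one measure. *)
Lemma inner_resolvent u : 0 < a -> inL2 u ->
  (\int[smeas E (gA u)]_t ((g t)^-1)%:E = (Re (inner (gA u) u))%:E)%E.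
Proof.
move=> ap u2; rewrite integral_affine_op//; last 2 first.
- by move=> t; rewrite lee_fin invr_ge0 affine_symbol_ge0.
- apply/measurable_EFinP; apply: measurable_funV_ge0; first exact: affine_symbol_ge0.
  exact: measurable_affine_symbol.
have := smeas_affine_op measurableT u2; rewrite projT//; last exact: affine_op_L2.
move=> <-; apply: eq_integral => t _; rewrite -EFinM expr2 mulrA mulVf ?mul1r//.
by rewrite gt_eqF// ltr_wpDr// mulr_ge0.
Qed.

End symbol.

Local Notation D := (spectral_dom E (@inv_sqrt R)).

Lemma smeas_unit_scale c f S : c * conjc c = 1 -> measurable S -> inL2 f ->
  smeas E (scale c f) S = smeas E f S.
Proof.
move=> c1 mS f2; rewrite !smeasE//; last exact: inL2Z.
have Sf2 := proj_L2 E mS f2.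
rewrite (linear_onZ (proj_linear E mS) c f2) (innerZl hq c Sf2 (inL2Z hq c f2)).
by rewrite (innerZr hq c f2 Sf2) mulrA c1 mul1r.
Qed.

Let m2 : measurable_fun setT (fun t : X => ((inv_sqrt t) ^+ 2)%:E).
Proof. by apply/measurable_EFinP; apply: measurable_funX; exact: measurable_inv_sqrt. Qed.

Let p2 (t : X) : (0 <= ((inv_sqrt t) ^+ 2)%:E)%E.
Proof. by rewrite lee_fin sqr_ge0. Qed.

Lemma spectral_dom_unit_scale c f : c * conjc c = 1 -> D f -> D (scale c f).
Proof.
move=> c1 [f2 If]; split; first exact: inL2Z.
rewrite (eq_measure_integral (smeas E f))// => S mS _.
exact: smeas_unit_scale.
Qed.

(** By the parallelogram law [E_(f+h) + E_(f-h) = 2 E_f + 2 E_h]. *)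
Lemma spectral_dom_add f h : D f -> D h -> D (add f h).
Proof.
move=> [f2 If] [h2 Ih]; split; first exact: inL2D.
have N1 : (-1 : C) * conjc (-1) = 1 by apply: complexP => /=; ring.
have nh2 : inL2 (scale (-1) h) by exact: inL2Z.
pose m := measure_add (smeas E (add f h)) (smeas E (add f (scale (-1) h))).
apply: (@le_lt_trans _ _ (\int[m]_t (inv_sqrt t ^+ 2)%:E)%E).
  rewrite ge0_integral_measure_add// leeDl//.
  by apply: integral_ge0 => t _; exact: p2.
rewrite (eq_measure_integral (measure_add (measure_add (smeas E f) (smeas E h))
   (measure_add (smeas E f) (smeas E h)))); last first.
  move=> S mS _; rewrite /m.
  have eqm : (smeas E (add f h) S + smeas E (add f (scale (-1) h)) S =
    (smeas E f S + smeas E h S) + (smeas E f S + smeas E h S))%E.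
    have Sf2 := proj_L2 E mS f2.
    rewrite (smeas_add mS f2 h2) (smeas_add mS f2 nh2) smeas_unit_scale//.
    rewrite (innerZr hq _ h2 Sf2) (_ : Re (conjc (-1) * inner (P S f) h) = - Re (inner (P S f) h)).
      by rewrite !smeasE// -!EFinD; congr (_%:E); ring.
    by rewrite cReM /=; ring.
  transitivity (smeas E (add f h) S + smeas E (add f (scale (-1) h)) S)%E.
    exact: measure_addE.
  rewrite eqm; apply/esym; apply: (etrans (measure_addE _ _ _)).
  by congr (_ + _)%E; exact: measure_addE.
have s := lte_add_pinfty If Ih.
rewrite !ge0_integral_measure_add//. exact: lte_add_pinfty.
Qed.

Variable Q : (T -> C) -> (T -> C).
Hypothesis EQ : spectral_integral E (@inv_sqrt R) Q.

Let iC1 : iC * conjc iC = 1.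
Proof. by apply: complexP => /=; ring. Qed.

Lemma inv_sqrt_op_symmetric f h : D f -> D h ->
  Re (inner (Q f) h) = Re (inner (Q h) f).
Proof.
case: EQ => QL2 Qlin Qform.
apply: (form_symmetric hq Qlin) => //.
- exact: spectral_dom_add.
- by move=> k; exact: spectral_dom_unit_scale.
- by move=> k [].
- by move=> k Dk; rewrite Qform.
Qed.

Lemma integral_inv_sqrt_fin f : D f ->
  (\int[smeas E f]_t (inv_sqrt t)%:E)%E \is a fin_num.
Proof.
move=> [f2 If]; rewrite ge0_fin_numE; last first.
  by apply: integral_ge0 => t _; rewrite lee_fin inv_sqrt_ge0.
apply: (@le_lt_trans _ _ (\int[smeas E f]_t (1%:E + ((inv_sqrt t) ^+ 2)%:E))%E).
  apply: ge0_le_integral => //.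
  - by move=> t _; rewrite lee_fin inv_sqrt_ge0.
  - by apply/measurable_EFinP; exact: measurable_inv_sqrt.
  - exact: emeasurable_funD.
  - move=> t _; rewrite -EFinD lee_fin; have := sqr_ge0 (inv_sqrt t - 1).
    by have := sqr_ge0 (inv_sqrt t); nra.
rewrite ge0_integralD//.
by rewrite integral_cst// mul1e lte_add_pinfty// smeas_fin.
Qed.

Lemma inv_sqrt_op_form f : D f ->
  (\int[smeas E f]_t (inv_sqrt t)%:E = (Re (inner (Q f) f))%:E)%E.
Proof.
by move=> Df; case: EQ => _ _ /(_ f Df) ->; rewrite /= fineK// integral_inv_sqrt_fin.
Qed.

Section resolvent.
Variables (a b : R).
Hypotheses (a0 : 0 < a) (b0 : 0 <= b).
Local Notation gA := (affine_op a b).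
Local Notation g := (affine_symbol a b).

Let a0' : 0 <= a := ltW a0.

Let g_gt0 t : 0 < g t.
Proof. by rewrite ltr_wpDr// mulr_ge0// le_max lexx orbT. Qed.

Let mgV : measurable_fun setT (fun t : X => (g t)^-1).
Proof.
by apply: measurable_funV_ge0 => [t|]; [exact: ltW|exact: measurable_affine_symbol].
Qed.

Lemma spectral_dom_resolvent u : inL2 u -> D (gA u) -> D u.
Proof.
move=> u2 [_ Iw]; split => //.
have -> : (\int[smeas E u]_t (inv_sqrt t ^+ 2)%:E =
    \int[smeas E (gA u)]_t (inv_sqrt t ^+ 2 * ((g t)^-1) ^+ 2)%:E)%E.
  rewrite integral_affine_op//; last 2 first.
  - by move=> t; rewrite lee_fin mulr_ge0 ?sqr_ge0.
  - apply/measurable_EFinP; apply: measurable_funM; apply: measurable_funX => //.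
    exact: measurable_inv_sqrt.
  apply: eq_integral => t _; rewrite -EFinM -mulrA -exprMn mulVf ?expr1n ?mulr1//.
  by rewrite gt_eqF.
apply: (@le_lt_trans _ _ ((a^-1 ^+ 2)%:E * \int[smeas E (gA u)]_t (inv_sqrt t ^+ 2)%:E)%E).
  rewrite -ge0_integralZl//; last by rewrite lee_fin sqr_ge0.
  apply: ge0_le_integral => //.
  - by move=> t _; rewrite lee_fin mulr_ge0 ?sqr_ge0.
  - apply/measurable_EFinP; apply: measurable_funM; apply: measurable_funX => //.
    exact: measurable_inv_sqrt.
  - exact: emeasurable_funM.
  - move=> t _; rewrite -EFinM lee_fin mulrC ler_wpM2r ?sqr_ge0//.
    rewrite ler_sqr ?nnegrE ?invr_ge0 ?(ltW (g_gt0 t))// lef_pV2 ?posrE//.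
    by rewrite lerDl mulr_ge0// le_max lexx orbT.
have : (0 <= \int[smeas E (gA u)]_t (inv_sqrt t ^+ 2)%:E)%E by apply: integral_ge0 => t _; exact: p2.
by move: Iw; case: (integral _ _ _) => //= r _ _; rewrite -EFinM ltry.
Qed.

(** The form of [Q] at [u + g(A) u], expanded as an integral and as a form, has
    cross terms [2 \int inv_sqrt g dE_u] and, by symmetry, [2 Re <Q u, g(A) u>]. *)
Lemma inner_inv_sqrt_resolvent u : inL2 u -> D (gA u) ->
  (\int[smeas E (gA u)]_t (inv_sqrt t / g t)%:E = (Re (inner (Q u) (gA u)))%:E)%E.
Proof.
move=> u2 Dw; have Du := spectral_dom_resolvent u2 Dw.
have -> : (\int[smeas E (gA u)]_t (inv_sqrt t / g t)%:E =
   \int[smeas E u]_t (inv_sqrt t * g t)%:E)%E.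
  rewrite integral_affine_op//; last 2 first.
  - by move=> t; rewrite lee_fin mulr_ge0 ?inv_sqrt_ge0// invr_ge0 ltW.
  - apply/measurable_EFinP; apply: measurable_funM => //; exact: measurable_inv_sqrt.
  apply: eq_integral => t _; rewrite -EFinM expr2 mulrA divfK ?gt_eqF//.
have mi : measurable_fun setT (fun t : X => (inv_sqrt t)%:E).
  by apply/measurable_EFinP; exact: measurable_inv_sqrt.
have i0 (t : X) : (0 <= (inv_sqrt t)%:E)%E by rewrite lee_fin inv_sqrt_ge0.
have := integral_affine_op_add a0' b0 u2 i0 mi.
rewrite !inv_sqrt_op_form//; last exact: spectral_dom_add.
case: EQ => QL2 Qlin _.
rewrite (form_add hq Qlin (fun h (Dh : D h) => proj1 Dh) QL2 Du Dw) !cReD.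
rewrite -(inv_sqrt_op_symmetric Du Dw).
have -> : (\int[smeas E u]_t ((inv_sqrt t)%:E * (2 * g t)%:E) =
   2%:E * \int[smeas E u]_t (inv_sqrt t * g t)%:E)%E.
  rewrite -ge0_integralZl//.
  - by apply: eq_integral => t _; rewrite -!EFinM; congr (_%:E); ring.
  - apply/measurable_EFinP; apply: measurable_funM; first exact: measurable_inv_sqrt.
    exact: measurable_affine_symbol.
  - by move=> t _; rewrite lee_fin mulr_ge0 ?inv_sqrt_ge0// ltW.
case: (integral _ _ _) => [r| |].
- rewrite -!EFinM -!EFinD => H; have eqr := EFin_inj H.
  by congr (_%:E); move: eqr => /addrI; lra.
- by rewrite gt0_muley ?lte_fin.
- by rewrite gt0_muleNy ?lte_fin.
Qed.

End resolvent.

End SpectralCalculus.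

(** * Levels in the tree *)

Section Tree.
Context (q : nat) (T : flow_tree q).
Local Notation e := (@adj q T).
Implicit Types (x y z : T).

Lemma dist_spec x y : is_walk e x y (dist x y) /\
  forall n, is_walk e x y n -> (dist x y <= n)%N.
Proof.
rewrite /dist /gdist; case: xgetP => [n _ [] //|H].
have [n wn] := adj_connected x y.
have ex : exists n, `[< is_walk e x y n >] by exists n; exact/asboolP.
exfalso; apply: (H (ex_minn ex)); case: ex_minnP => m /asboolP wm min.
by split => // k wk; apply: min; exact/asboolP.
Qed.

Lemma dist_walk x y : exists p, [/\ path e x p, last x p = y & size p = dist x y].
Proof. exact: (dist_spec x y).1. Qed.

Lemma dist_le x p : path e x p -> (dist x (last x p) <= size p)%N.
Proof. by move=> xp; apply: (dist_spec x _).2; exists p. Qed.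

Lemma adjC x y : e x y = e y x.
Proof. exact: adj_sym. Qed.

Lemma rev_walk x p : path e x p ->
  exists p', [/\ path e (last x p) p', last (last x p) p' = x & size p' = size p].
Proof.
move=> xp; exists (rev (belast x p)); split.
- by rewrite rev_path (eq_path (e' := e)) // => a b; rewrite adjC.
- case: p xp => //= a p _; by rewrite rev_cons last_rcons.
- by rewrite size_rev size_belast.
Qed.

Lemma distC x y : dist x y = dist y x.
Proof.
suff le (a b : T) : (dist a b <= dist b a)%N by apply/eqP; rewrite eqn_leq !le.
have [p [bp pa <-]] := dist_walk b a; have [p' [pp' lp' <-]] := rev_walk bp.
by rewrite pa in pp' lp'; rewrite -[X in dist _ X]lp'; exact: dist_le.
Qed.

Lemma distxx x : dist x x = 0%N.
Proof. by apply/eqP; rewrite -leqn0; apply: (@dist_le x [::]). Qed.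

Lemma dist0_eq x y : dist x y = 0%N -> x = y.
Proof. by have [p [_ <- <-]] := dist_walk x y; case: p. Qed.

Lemma dist_triangle x y z : (dist x z <= dist x y + dist y z)%N.
Proof.
have [p [xp py <-]] := dist_walk x y; have [p' [yp' pz <-]] := dist_walk y z.
by rewrite -size_cat -pz -py -last_cat dist_le// cat_path xp py.
Qed.

Lemma dist_adj x y : e x y -> dist x y = 1%N.
Proof.
move=> xy; apply/eqP; rewrite eqn_leq (@dist_le x [:: y]) /= ?xy//.
rewrite lt0n; apply/eqP => /dist0_eq xE; move: xy; rewrite xE.
by rewrite adj_irr.
Qed.

Lemma dist1_adj x y : dist x y = 1%N -> e x y.
Proof.
have [p [xp <- <-]] := dist_walk x y; case: p xp => // a [|//] /=.
by rewrite andbT.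
Qed.

Lemma dist_adj_le rho x y : e x y -> (dist rho x <= (dist rho y).+1)%N.
Proof.
move=> xy; rewrite -addn1 -(dist_adj (x := y) (y := x)) ?dist_triangle//.
by rewrite adjC.
Qed.

Lemma closer_neighbour rho x : rho <> x ->
  exists2 y, e x y & dist rho x = (dist rho y).+1.
Proof.
move=> rx; have [p [pp lx sp]] := dist_walk rho x.
case/lastP: p => [|p y] in pp lx sp *; first by case: rx.
rewrite last_rcons in lx; move: pp; rewrite rcons_path lx => /andP[pp pe].
exists (last rho p); first by rewrite adjC.
apply/eqP; rewrite eqn_leq; apply/andP; split.
  by apply: dist_adj_le; rewrite adjC.
by rewrite -sp size_rcons ltnS dist_le.
Qed.

(** A walk joining two distinct neighbours of a vertex and avoiding it would
    close up into a cycle. *)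
Lemma no_detour x y y' p : e x y -> e x y' -> y <> y' ->
  path e y p -> last y p = y' -> x \notin y :: p -> False.
Proof.
move=> xy xy' yy' yp; case/shortenP: yp => p' yp' up' sub lp' xNp.
have xNp' : x \notin y :: p'.
  move: xNp; rewrite !inE !negb_or => /andP[-> /=]; apply: contra.
  exact: sub.
apply: (@adj_acyclic q T [:: x, y & p']).
  by case: p' lp' {yp' up' sub xNp'} => // /yy'.
rewrite /ucycle; apply/andP; split; last by rewrite /= xNp'.
by rewrite /= xy rcons_path yp' lp' adjC xy'.
Qed.

Lemma geodesic_from_avoids rho x y : x <> y -> (dist rho y <= dist rho x)%N ->
  exists p, [/\ path e rho p, last rho p = y & x \notin rho :: p].
Proof.
move=> xy yx; have [p [pp lp sp]] := dist_walk rho y; exists p; split => //.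
apply/negP => xp; move: pp lp sp; case/splitPl: xp => p1 p2 lx.
rewrite cat_path last_cat lx size_cat => /andP[pp1 _] lp sp.
have : (0 < size (p2 : seq T))%N by case: p2 lp {sp} => //= /xy.
have := dist_le pp1; rewrite lx; move: yx; rewrite -sp; lia.
Qed.

Lemma geodesic_to_avoids rho x y : x <> y -> (dist rho y <= dist rho x)%N ->
  exists p, [/\ path e y p, last y p = rho & x \notin y :: p].
Proof.
move=> xy yx; have [p [pp lp sp]] := dist_walk y rho; exists p; split => //.
apply/negP => xp; move: pp lp sp; case/splitPl: xp => p1 p2 lx.
rewrite cat_path last_cat lx size_cat => /andP[_ pp2] lp sp.
have : (0 < size (p1 : seq T))%N by case: p1 lx {sp} => //= /esym /xy.
have := dist_le pp2; rewrite lp distC; move: yx; rewrite (distC _ y) -sp; lia.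
Qed.

Lemma adj_neq x y : e x y -> x <> y.
Proof. by move=> + xy; rewrite xy adj_irr. Qed.

(** Two such neighbours would be joined, through the root, by a walk whose inner
    vertices are closer to the root than [x], and which thus avoids it. *)
Lemma neighbour_unique rho x y y' : e x y -> e x y' ->
  (dist rho y <= dist rho x)%N -> (dist rho y' <= dist rho x)%N -> y = y'.
Proof.
move=> xy xy' dy dy'; apply/eqP/negPn/negP => /eqP yy'.
have [p [yp pr xp]] := geodesic_to_avoids (adj_neq xy) dy.
have [p' [rp' p'y xp']] := geodesic_from_avoids (adj_neq xy') dy'.
apply: (@no_detour x y y' (p ++ p')) => //.
- by rewrite cat_path yp pr.
- by rewrite last_cat pr.
- by rewrite -cat_cons mem_cat negb_or xp/=; move: xp'; rewrite inE negb_or => /andP[].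
Qed.

Lemma dist_adj_neq rho x y : e x y -> dist rho x <> dist rho y.
Proof.
move=> xy dxy; have [rx|rx] := pselect (rho = x).
  move: dxy; rewrite -rx distxx => /esym/dist0_eq ry.
  by apply: (adj_neq xy); rewrite -rx.
have [z xz dz] := closer_neighbour rx.
have zy : z = y by apply: (@neighbour_unique rho x) => //; lia.
by move: dz; rewrite zy dxy; lia.
Qed.

Local Notation r := (ray T).

Lemma dist_ray m n : dist (r m) (r n) = (maxn m n - minn m n)%N.
Proof.
have [mn|nm] := leqP m n; first exact: ray_geodesic.
by rewrite distC; apply: ray_geodesic; exact: ltnW.
Qed.

Lemma ray_adj n : e (r n) (r n.+1).
Proof. by apply: dist1_adj; rewrite dist_ray; lia. Qed.

Lemma ray_inj m n : r m = r n -> m = n.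
Proof. by move=> mn; have := dist_ray m n; rewrite mn distxx; lia. Qed.

Lemma confluent_spec x : exists k, confluent x = r k /\
  forall n, (dist x (r k) <= dist x (r n))%N.
Proof.
rewrite /confluent; case: xgetP => [y _ [[k _ <-] H]|H]; first by exists k.
have ex : exists d, `[< exists n, dist x (r n) = d >].
  by exists (dist x (r 0)); apply/asboolP; exists 0%N.
exfalso; case: (ex_minnP ex) => d /asboolP [k kd] min.
apply: (H (r k)); split; first by exists k.
by move=> n; rewrite kd; apply: min; apply/asboolP; exists n.
Qed.

Lemma dist_ray_step x n : dist x (r n.+1) = (dist x (r n)).+1 \/
  dist x (r n) = (dist x (r n.+1)).+1.
Proof.
have a := ray_adj n; have := @dist_adj_neq x _ _ a; have := dist_adj_le x a.
have := dist_adj_le (x := r n.+1) (y := r n) x; rewrite adjC => /(_ a); lia.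
Qed.

(** If the distance to [x] dropped right after a rise, the vertex of the ray in
    between would have two neighbours that are not farther from [x]. *)
Lemma dist_ray_after x k : (forall n, (dist x (r k) <= dist x (r n))%N) ->
  forall n, dist x (r (k + n)) = (dist x (r k) + n)%N.
Proof.
move=> mink; have H n : dist x (r (k + n)) = (dist x (r k) + n)%N /\
    dist x (r (k + n).+1) = (dist x (r k) + n).+1.
  elim: n => [|n [IH1 IH2]].
    by rewrite !addn0; split => //; have := mink k.+1; have := dist_ray_step x k; lia.
  rewrite !addnS; split => //.
  have [up|down] := dist_ray_step x (k + n).+1; first by rewrite up IH2.
  suff : r (k + n) = r (k + n).+2 by move/ray_inj; lia.
  apply: (@neighbour_unique x (r (k + n).+1)).
  - by rewrite adjC ray_adj.
  - exact: ray_adj.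
  - by rewrite IH1 IH2.
  - by rewrite down.
by move=> n; have [] := H n.
Qed.

(** The level is the Busemann function of the ray: seen from [x], it is read off
    any vertex of the ray far enough out, which serves as a common root for
    comparing neighbours. *)
Lemma levelE x : exists N, forall n, (N <= n)%N ->
  level x = n%:Z - (dist x (r n))%:Z.
Proof.
have [k [ck mink]] := confluent_spec x; exists k => n kn.
rewrite /level ck -(ray0 T) dist_ray.
have := dist_ray_after mink (n - k); rewrite subnKC// => ->.
lia.
Qed.

Lemma level_adj x y : e x y -> level y = level x + 1 \/ level y = level x - 1.
Proof.
move=> xy; have [N HN] := levelE x; have [M HM] := levelE y.
have n1 : (N <= N + M)%N by lia.
have n2 : (M <= N + M)%N by lia.
rewrite (HN _ n1) (HM _ n2); move: (N + M)%N => n.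
have a : e y x by rewrite adjC.
have := @dist_adj_neq (r n) _ _ xy; have := dist_adj_le (r n) xy.
have := dist_adj_le (r n) a; rewrite !(distC (r n)); lia.
Qed.

(** By the triangle inequality [n - d(x, r n)] does not decrease with [n]. *)
Lemma le_level x n : n%:Z - (dist x (r n))%:Z <= level x.
Proof.
have [N HN] := levelE x.
have nm : (N <= maxn n N)%N by lia.
rewrite (HN _ nm); have := dist_triangle x (r n) (r (maxn n N)).
rewrite dist_ray; lia.
Qed.

(** A neighbour closer to a remote vertex of the ray has level at least
    [level x + 1] by monotonicity, and at most that since it is a neighbour. *)
Lemma parent_exists x : exists y, e x y /\ level y = level x + 1.
Proof.
have [N HN] := levelE x.
pose n := (N + `|level x| + 1)%N.
have Nn : (N <= n)%N by rewrite /n; lia.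
have rx : r n <> x.
  move=> rx; have h := HN n Nn.
  have d0 : dist x (r n) = 0%N by rewrite rx distxx.
  by rewrite d0 /n in h; lia.
have [y xy dy] := closer_neighbour rx; exists y; split => //.
have := le_level y n; have := HN n Nn; have := level_adj xy.
move: dy; rewrite !(distC (r n)); lia.
Qed.

Lemma parent_unique x y y' : e x y -> e x y' ->
  level y = level x + 1 -> level y' = level x + 1 -> y = y'.
Proof.
move=> xy xy' ly ly'.
have [N HN] := levelE x; have [M HM] := levelE y; have [K HK] := levelE y'.
pose n := (N + M + K)%N.
have n1 : (N <= n)%N by rewrite /n; lia.
have n2 : (M <= n)%N by rewrite /n; lia.
have n3 : (K <= n)%N by rewrite /n; lia.
have := HN n n1; have := HM n n2; have := HK n n3 => h1 h2 h3.
by apply: (@neighbour_unique (r n) x) => //; rewrite !(distC (r n)); lia.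
Qed.

(** Locked, as unification would otherwise unfold levels down to distances. *)
Definition parent : T -> T :=
  locked (fun x => xget x [set y | e x y /\ level y = level x + 1]).

Lemma parent_spec x : e x (parent x) /\ level (parent x) = level x + 1.
Proof.
rewrite /parent -lock; case: xgetP => [y _ //|H]; have [y Hy] := parent_exists x.
by have := H y Hy.
Qed.

Lemma level_parent x : level (parent x) = level x + 1.
Proof. exact: (parent_spec x).2. Qed.

Lemma succsE x y : succs x y <-> parent y = x.
Proof.
split=> [[xy ly]|<-].
  have [py lpy] := parent_spec y.
  by apply: (@parent_unique y) => //; [rewrite adjC|rewrite ly; lia].
have [py lpy] := parent_spec y; split; first by rewrite adjC.
by rewrite lpy; lia.
Qed.

Lemma adjE x : [set y | e x y] = parent x |` succs x.
Proof.
apply/seteqP; split => y /=.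
  move=> xy; have [ly|ly] := level_adj xy; last by right.
  by left; have [px lpx] := parent_spec x; apply: (@parent_unique x).
by case=> [->|[]//]; have [] := parent_spec x.
Qed.

Lemma parent_notin_succs x : ~ succs x (parent x).
Proof. by case=> _; rewrite level_parent; lia. Qed.

Lemma succs_finite x : finite_set (succs x).
Proof.
apply: (@sub_finite_set _ _ [set y | e x y]); first by move=> y [].
by exists q.+1; exact: adj_regular.
Qed.

Lemma succs_card x : size (finmap.enum_fset (fset_set (succs x))) = q.
Proof.
have := card_fset_set (adj_regular x).
rewrite adjE fset_setU1; last exact: succs_finite.
rewrite finmap.cardfsU1 in_fset_set; last exact: succs_finite.
by rewrite (memNset (@parent_notin_succs x)) => -[].
Qed.

End Tree.

(** * The flow Laplacian *)

Section Flow.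
Context (R : realType) (q : nat) (hq : (2 <= q)%N) (T : flow_tree q).
Local Notation C := R[i].
Local Notation normc := ComplexField.Normc.normc.
Local Notation Re := complex.Re.
Local Notation Im := complex.Im.
Implicit Types (x y : T) (f g : T -> C).

Let q_gt0 : 0 < q%:R :> R.
Proof. by rewrite ltr0n; apply: leq_trans hq. Qed.

Let q_neq0 : q%:R != 0 :> R.
Proof. by rewrite gt_eqF. Qed.

Lemma mu_parent x : mu R (parent x) = q%:R * mu R x.
Proof. by rewrite /mu level_parent addrC expfzDr// expr1z. Qed.

(** The sets of successors partition the tree, each vertex having exactly one
    predecessor. *)
Lemma esum_succs (G : T -> R) : (forall x, 0 <= G x) ->
  (\esum_(x in [set: T]) (\sum_(y \in succs x) G y)%:E =
   \esum_(x in [set: T]) (G x)%:E)%E.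
Proof.
move=> G0.
rewrite (eq_esum (b := fun x => (\esum_(y in succs x) (G y)%:E)%E)); last first.
  move=> x _; have fs := succs_finite x.
  by rewrite esum_fset ?fsumEFin// => y _; rewrite lee_fin.
rewrite (esum_esum (I := [set: T]) (J := @succs q T) (a := fun _ y => (G y)%:E)) => [|x y _ _]; last by rewrite lee_fin.
rewrite (@reindex_esum R T (T * T)%type setT _ (fun y => (parent y, y)))//.
split.
- by move=> y _ /=; split => //; apply/succsE.
- by move=> y y' _ _ [].
- by move=> [x y] /= [_ /succsE yx]; exists y => //; rewrite yx.
Qed.

Lemma sum_succs_const x (c : R) : \sum_(y \in succs x) c = q%:R * c.
Proof.
rewrite fsbig_finite; last exact: succs_finite.
rewrite big_const_seq count_predT iter_addr addr0 mulr_natl.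
by congr (_ *+ _); exact: succs_card.
Qed.

Lemma sum_succs_mu x (F : T -> R) :
  \sum_(y \in succs x) F y * mu R y = q%:R^-1 * (\sum_(y \in succs x) F y) * mu R x.
Proof.
rewrite !fsbig_finite; try exact: succs_finite.
rewrite -mulrA mulr_suml mulr_sumr; apply: eq_big_seq => y.
rewrite in_fset_set; last exact: succs_finite.
move=> /set_mem/succsE <-; rewrite mu_parent; field.
exact: q_neq0.
Qed.

(** The flow condition, that a vertex weighs as much as its successors together,
    makes this average and composition with the predecessor preserve mass. *)
Lemma esum_average_succs (F : T -> R) : (forall x, 0 <= F x) ->
  (\esum_(x in [set: T]) (q%:R^-1 * (\sum_(y \in succs x) F y) * mu R x)%:E =
   \esum_(x in [set: T]) (F x * mu R x)%:E)%E.
Proof.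
move=> F0; rewrite -[RHS]esum_succs => [|x]; last by rewrite mulr_ge0// ltW ?mu_gt0.
by apply: eq_esum => x _; rewrite sum_succs_mu.
Qed.

Lemma esum_parent (F : T -> R) : (forall x, 0 <= F x) ->
  (\esum_(x in [set: T]) (F (parent x) * mu R x)%:E =
   \esum_(x in [set: T]) (F x * mu R x)%:E)%E.
Proof.
move=> F0; rewrite -[LHS]esum_succs => [|x]; last by rewrite mulr_ge0// ltW ?mu_gt0.
apply: eq_esum => x _; rewrite sum_succs_mu; congr (_ * _)%:E.
rewrite (eq_fsbigr (fun=> F x)) => [|y]; last by move=> /set_mem/succsE ->.
by rewrite sum_succs_const mulrA mulVf ?mul1r.
Qed.

Lemma laplacianE f x : laplacian f x = f x - (2^-1)%:C * f (parent x)
  - ((2 * q%:R)^-1)%:C * \sum_(y \in succs x) f y.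
Proof.
have sq0 : Num.sqrt (q%:R : R) != 0 by rewrite sqrtr_eq0 -ltNge.
have sqq : Num.sqrt (q%:R : R) * Num.sqrt q%:R = q%:R by rewrite -expr2 sqr_sqrtr// ltW.
rewrite /laplacian adjE fsbigU0//=; [|exact: succs_finite|]; last first.
  by move=> y [-> /parent_notin_succs].
rewrite fsbig_set1 mulrDr opprD addrA; congr (_ - _ - _).
  rewrite mulrA -rmorphM; congr (_%:C * _).
  rewrite mu_parent sqrtrM ?ltW// mulfK ?sqrtr_eq0 -?ltNge ?mu_gt0//.
  by rewrite invfM -mulrA mulVf ?mulr1.
rewrite !fsbig_finite; try exact: succs_finite.
rewrite !mulr_sumr; apply: eq_big_seq => y.
rewrite in_fset_set; last exact: succs_finite.
move=> /set_mem/succsE <-.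
rewrite mulrA -rmorphM; congr (_%:C * _).
have sm0 : Num.sqrt (mu R y) != 0 by rewrite sqrtr_eq0 -ltNge mu_gt0.
rewrite mu_parent sqrtrM ?ltW// -{3}sqq; field.
by rewrite sq0 sm0.
Qed.

Let Re_mul_conj_le (z w : C) :
  Re (z * conjc w) <= 2^-1 * (normc z ^+ 2 + normc w ^+ 2).
Proof.
rewrite !sqr_normc; case: z w => [a b] [c d] /=.
have := sqr_ge0 (a - c); have := sqr_ge0 (b - d); nra.
Qed.

Let Re_realM (r : R) (z : C) : Re (r%:C * z) = r * Re z.
Proof. by rewrite cReM [Re _%:C]/= [Im _%:C]/= mul0r subr0. Qed.

(** The product with a neighbouring value is at most half the sum of the squares.
    After summation each of the two averages on the left has the mass of
    [normc f ^+ 2], and the three terms cancel. *)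
Lemma laplacian_form_ge f x :
  2^-1 * normc (f x) ^+ 2 - 4^-1 * normc (f (parent x)) ^+ 2
    - 4^-1 * (q%:R^-1 * \sum_(y \in succs x) normc (f y) ^+ 2)
  <= Re (laplacian f x * conjc (f x)).
Proof.
have -> : laplacian f x * conjc (f x) = f x * conjc (f x) +
    (- 2^-1)%:C * (f (parent x) * conjc (f x)) +
    (- (2 * q%:R)^-1)%:C * ((\sum_(y \in succs x) f y) * conjc (f x)).
  by rewrite laplacianE !rmorphN; ring.
rewrite !cReD !Re_realM.
have fx : Re (f x * conjc (f x)) = normc (f x) ^+ 2.
  by rewrite sqr_normc; case: (f x) => a b /=; ring.
have fp := Re_mul_conj_le (f (parent x)) (f x).
have fs : Re ((\sum_(y \in succs x) f y) * conjc (f x)) <=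
    2^-1 * \sum_(y \in succs x) normc (f y) ^+ 2 + 2^-1 * (q%:R * normc (f x) ^+ 2).
  rewrite -(sum_succs_const x) !fsbig_finite; try exact: succs_finite.
  rewrite mulr_suml (big_morph (@complex.Re R) (@cReD R) (erefl : Re 0 = 0)).
  rewrite !mulr_sumr -big_split/=; apply: ler_sum => y _.
  by rewrite -mulrDr; exact: Re_mul_conj_le.
have q2 : (2 * q%:R)^-1 = 2^-1 * q%:R^-1 :> R by rewrite invfM.
have qV : 0 < q%:R^-1 :> R by rewrite invr_gt0.
have := ler_wpM2l (ltW qV) fs; rewrite fx q2.
set S := \sum_(y \in succs x) normc _ ^+ 2; set s := Re _.
rewrite mulrDr [q%:R^-1 * (2^-1 * (q%:R * _))]mulrCA [q%:R^-1 * (q%:R * _)]mulrA mulVf// mul1r.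
rewrite [q%:R^-1 * (2^-1 * _)]mulrCA => h; rewrite !mulNr -mulrA; lra.
Qed.

Lemma laplacian_ge0 f : inL2 f -> inL2 (laplacian f) ->
  0 <= Re (inner (laplacian f) f).
Proof.
move=> f2 lf2.
pose N x := normc (f x) ^+ 2.
have N0 x : 0 <= N x by rewrite sqr_ge0.
pose M x := q%:R^-1 * \sum_(y \in succs x) N y.
have M0 x : 0 <= M x.
  by rewrite mulr_ge0 ?invr_ge0 ?ler0n// fsbig_finite ?sumr_ge0//; exact: succs_finite.
have mu0 := fun x => ltW (mu_gt0 R hq x).
have sN : (\esum_(x in [set: T]) (N x * mu R x)%:E < +oo)%E by exact: f2.
have abs (F : T -> R) : (forall x, 0 <= F x) ->
    (\esum_(x in [set: T]) (F x * mu R x)%:E < +oo)%E -> rsummable (fun x => F x * mu R x).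
  by move=> F0; apply: le_rsummable => x; rewrite ger0_norm// mulr_ge0.
have s1 := abs _ N0 sN.
have s2 : rsummable (fun x => N (parent x) * mu R x).
  by apply: (abs (fun x => N (parent x))) => //; rewrite esum_parent.
have s3 : rsummable (fun x => M x * mu R x).
  by apply: abs => //; rewrite esum_average_succs.
have E2 : rsum (fun x => N (parent x) * mu R x) = rsum (fun x => N x * mu R x).
  by rewrite !rsum_ge0E ?esum_parent// => x; rewrite mulr_ge0.
have E3 : rsum (fun x => M x * mu R x) = rsum (fun x => N x * mu R x).
  by rewrite !rsum_ge0E ?esum_average_succs// => x; rewrite mulr_ge0.
have := rsum_lin3 (- 4^-1) (- 4^-1) s2 s3 (rsummableZ 2^-1 s1).
rewrite rsumZ// E2 E3 => E0.
have {}E0 : rsum (fun x => - 4^-1 * (N (parent x) * mu R x) +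
   - 4^-1 * (M x * mu R x) + 2^-1 * (N x * mu R x)) = 0 by rewrite E0; lra.
rewrite -E0; apply: le_rsum.
- exact: rsummableD (rsummableD (rsummableZ _ s2) (rsummableZ _ s3)) (rsummableZ _ s1).
- have H := inL1_Re hq (inL2_mul hq lf2 f2); exact: H.
- move=> x; rewrite !mulrA -!mulrDl ler_wpM2r//.
  apply: le_trans (laplacian_form_ge f x); rewrite /M /N; lra.
Qed.

Section geometric.
Variables (w : T -> C) (L : int) (r : R).

(** Extends a function on level [L] downwards, with ratio [r] at each step. In
    terms of the depth [n] below level [L] the Laplacian acts on functions
    [phi n * w (p^n x)] as the Dirichlet Laplacian
    [phi n - (phi n.-1 + phi n.+1) / 2] of the half-line, of which the powers of
    [r] are generalized eigenfunctions away from the origin. *)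
Definition geometric x : C :=
  if level x <= L then (r ^+ `|L - level x|%N)%:C * w (iter `|L - level x|%N (@parent q T) x)
  else 0.

Hypotheses (wL : forall x, w x <> 0 -> level x = L)
  (w0 : forall x, \sum_(y \in succs x) w y = 0).

Lemma geometric_level x : level x = L -> geometric x = w x.
Proof. by move=> lx; rewrite /geometric lx lexx subrr /= expr0 mul1r. Qed.

Lemma geometric_above x : L < level x -> geometric x = 0.
Proof. by move=> Lx; rewrite /geometric leNgt Lx. Qed.

Lemma geometric_below x : level x < L -> geometric x = r%:C * geometric (parent x).
Proof.
move=> xL; rewrite /geometric level_parent (ltW xL) ifT; last by lia.
have -> : absz (L - level x)%R = (absz (L - (level x + 1))%R).+1 by lia.
by rewrite iterSr exprS rmorphM mulrA.
Qed.

Lemma mul_conj_geometric x : w x * conjc (geometric x) = w x * conjc (w x).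
Proof.
have [->|/eqP wx] := eqVneq (w x) 0; first by rewrite !mul0r.
by rewrite geometric_level// wL.
Qed.

Let wN x : level x <> L -> w x = 0.
Proof. by move=> lx; apply: contrapT => /wL. Qed.

(** Below level [L] this is the quadratic equation of which [r] is a root; on
    level [L] the missing value at the predecessor leaves exactly [w]; one level
    higher the sum of [w] over the successors vanishes. *)
Lemma geometric_resolvent x :
  ((1 - r) ^+ 2)%:C * geometric x + (2 * r)%:C * laplacian geometric x = w x.
Proof.
have q2 : (2 * r)%:C * ((2 * q%:R)^-1)%:C = (r / q%:R)%:C :> C.
  by rewrite -rmorphM; congr (_%:C); field.
have h2 : (2 * r)%:C * (2^-1)%:C = r%:C :> C.
  by rewrite -rmorphM; congr (_%:C); field.
have ab : ((1 - r) ^+ 2)%:C + (2 * r)%:C = (1 + r ^+ 2)%:C :> C.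
  by rewrite -rmorphD; congr (_%:C); ring.
rewrite laplacianE !mulrBr addrA addrA -mulrDl ab !mulrA h2 q2.
have sumE : level x <= L -> (r / q%:R)%:C * (\sum_(y \in succs x) geometric y) =
   (r ^+ 2)%:C * geometric x.
  move=> xL; rewrite (eq_fsbigr (fun=> r%:C * geometric x)); last first.
    move=> y /set_mem/succsE yx; rewrite geometric_below ?yx//.
    by have := level_parent y; rewrite yx; lia.
  rewrite fsbig_finite; last exact: succs_finite.
  rewrite big_const_seq count_predT iter_addr addr0.
  have -> : size (finmap.enum_fset (fset_set (succs x))) = q by exact: succs_card.
  rewrite -[(r%:C * geometric x) *+ q]mulr_natl mulrA mulrA -(rmorph_nat (real_complex R)) -!rmorphM.
  by congr (_%:C * _); field.
have [xL|Lx|xL] := ltgtP (level x) L.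
- rewrite sumE ?ltW// -geometric_below// wN; last by lia.
  by rewrite rmorphD rmorph1; ring.
- rewrite geometric_above// (geometric_above (x := parent x)); last by rewrite level_parent; lia.
  rewrite !mulr0 subr0 sub0r wN; last by lia.
  have [L1|L1] := eqVneq (level x) (L + 1).
    rewrite (eq_fsbigr w) ?w0 ?mulr0 ?oppr0// => y /set_mem/succsE yx.
    by rewrite geometric_level//; have := level_parent y; rewrite yx; lia.
  rewrite fsbig1 ?mulr0 ?oppr0// => y /succsE yx.
  by rewrite geometric_above//; have := level_parent y; rewrite yx; lia.
- rewrite sumE ?xL// (geometric_above (x := parent x)); last by rewrite level_parent; lia.
  by rewrite geometric_level// rmorphD rmorph1; ring.
Qed.

Lemma normc_geometric (M : R) : 0 <= r <= 1 -> 0 <= M -> (forall x, normc (w x) <= M) ->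
  forall x, normc (geometric x) <= M.
Proof.
move=> /andP[r0 r1] M0 wM x; rewrite /geometric; case: ifP => _; last first.
  by rewrite ComplexField.Normc.normc0.
rewrite ComplexField.Normc.normcM /= expr0n/= addr0 sqrtr_sqr ger0_norm ?exprn_ge0//.
by rewrite -[leRHS]mul1r ler_pM ?exprn_ge0 ?normc_ge0 ?exprn_ile1.
Qed.

Let esum_iter_parent (F : T -> R) n : (forall x, 0 <= F x) ->
  (\esum_(x in [set: T]) (F (iter n (@parent q T) x) * mu R x)%:E =
   \esum_(x in [set: T]) (F x * mu R x)%:E)%E.
Proof.
move=> F0; elim: n => // n <-.
by rewrite -[RHS]esum_parent//; apply: eq_esum => x _; rewrite iterSr.
Qed.

(** The mass of [normc _ ^+ 2] at depth [n] is [r^(2n)] times that of [w], because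
    composition with the predecessor preserves mass. *)
Lemma geometric_L2 : 0 <= r < 1 -> inL2 w -> inL2 geometric.
Proof.
move=> /andP[r0 r1] w2; pose rho := r ^+ 2.
have rho0 : 0 <= rho by rewrite sqr_ge0.
have rho1 : rho < 1 by rewrite expr_lt1.
pose N x := normc (w x) ^+ 2.
have N0 x : 0 <= N x by rewrite sqr_ge0.
have mu0 := fun x => ltW (mu_gt0 R hq x).
pose a x n := (rho ^+ n * (N (iter n (@parent q T) x) * mu R x))%:E.
have a0 x n : (0 <= a x n)%E by rewrite lee_fin mulr_ge0 ?exprn_ge0// mulr_ge0.
have S0 : (0 <= sqnorm2 w)%E.
  by apply: esum_ge0 => x _; rewrite lee_fin mulr_ge0 ?sqr_ge0.
pose S := fine (sqnorm2 w).
have SE : sqnorm2 w = S%:E by rewrite fineK// ge0_fin_numE.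
have S0' : 0 <= S by rewrite fine_ge0.
apply: (@le_lt_trans _ _ (\esum_(x in [set: T]) \esum_(n in [set: nat]) a x n)%E).
  apply: le_esum => x _; rewrite /geometric; case: ifP => xL; last first.
    by rewrite ComplexField.Normc.normc0 expr0n/= mul0r; apply: esum_ge0.
  apply: esum_ge; exists [set `|L - level x|%N]; first by split.
  rewrite fsbig_set1 /a lee_fin /N ComplexField.Normc.normcM exprMn.
  have -> : normc (r ^+ `|L - level x|%N)%:C ^+ 2 = rho ^+ `|L - level x|%N.
    by rewrite sqr_normc/= expr0n/= addr0 -!exprM mulnC.
  by rewrite -mulrA.
have -> : (\esum_(x in [set: T]) \esum_(n in [set: nat]) a x n =
   \esum_(n in [set: nat]) \esum_(x in [set: T]) a x n)%E.
  rewrite !esum_esum// (@reindex_esum R (nat * T)%type (T * nat)%type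
     ([set: nat] `*`` (fun=> [set: T])) _ (fun k => (k.2, k.1)))//.
  by split=> // [[m x] [n y] _ _ [-> ->]//|[x n] _]; exists (n, x).
rewrite -nneseries_esumT; last by move=> n; apply: esum_ge0.
apply: (@le_lt_trans _ _ (S / (1 - rho))%:E); last by rewrite ltry.
apply: lime_le; first by apply: is_cvg_nneseries => n _ _; apply: esum_ge0.
apply: nearW => K.
have aE n : (\esum_(x in [set: T]) a x n = (rho ^+ n * S)%:E)%E.
  rewrite esumZl ?exprn_ge0//; last by move=> x; rewrite mulr_ge0.
  by rewrite esum_iter_parent// EFinM -SE.
under eq_bigr do rewrite aE.
rewrite sumEFin lee_fin -mulr_suml mulrC ler_wpM2l// big_mkord.
have rp : 0 < 1 - rho by rewrite subr_gt0.
rewrite -[leRHS]mul1r ler_pdivlMr//.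
have rhoK : 0 <= rho ^+ K by rewrite exprn_ge0.
have -> : (\sum_(i < K) rho ^+ i) * (1 - rho) = - ((rho - 1) * \sum_(i < K) rho ^+ i) by ring.
by rewrite -subrX1; lra.
Qed.

End geometric.

End Flow.

(** * Finitely supported functions *)

Section FiniteSupport.
Context (R : realType) (q : nat) (hq : (2 <= q)%N) (T : flow_tree q).
Local Notation C := R[i].
Local Notation normc := ComplexField.Normc.normc.
Local Notation Re := complex.Re.
Local Notation Im := complex.Im.
Implicit Types (x y a : T) (u f : T -> C).

Lemma integral_mu_fin (A : set T) u : finite_set A -> (forall x, ~ A x -> u x = 0) ->
  integral_mu u = \sum_(x \in A) u x * (mu R x)%:C.
Proof.
move=> fA uA; apply: complexP.
  rewrite /= (rsum_fin fA); last by move=> x /uA ->; rewrite mul0r.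
  rewrite !fsbig_finite// (big_morph (@complex.Re R) (@cReD R) (erefl : Re 0 = 0)).
  by apply: eq_bigr => x _; rewrite cReM /= mulr0 subr0.
rewrite /= (rsum_fin fA); last by move=> x /uA ->; rewrite mul0r.
rewrite !fsbig_finite// (big_morph (@complex.Im R) (@cImD R) (erefl : Im 0 = 0)).
by apply: eq_bigr => x _; rewrite cImM /= mulr0 add0r.
Qed.

Lemma inL1_fin (A : set T) u : finite_set A -> (forall x, ~ A x -> u x = 0) -> inL1 u.
Proof.
move=> fA uA; have mu0 := fun x => ltW (mu_gt0 R hq x).
have := @rsummable_fin R q T A (fun x => normc (u x) * mu R x) fA.
rewrite /rsummable /inL1 /norm1 => H.
rewrite (eq_esum (b := fun x => `|normc (u x) * mu R x|%:E)).
  by apply: H => x /uA ->; rewrite ComplexField.Normc.normc0 mul0r.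
by move=> x _; rewrite ger0_norm// mulr_ge0 ?normc_ge0.
Qed.

Lemma inL2_fin (A : set T) u : finite_set A -> (forall x, ~ A x -> u x = 0) -> inL2 u.
Proof.
move=> fA uA; have mu0 := fun x => ltW (mu_gt0 R hq x).
have := @rsummable_fin R q T A (fun x => normc (u x) ^+ 2 * mu R x) fA.
rewrite /rsummable /inL2 /sqnorm2 => H.
rewrite (eq_esum (b := fun x => `|normc (u x) ^+ 2 * mu R x|%:E)).
  by apply: H => x /uA ->; rewrite ComplexField.Normc.normc0 expr0n/= mul0r.
by move=> x _; rewrite ger0_norm// mulr_ge0 ?sqr_ge0.
Qed.

Definition delta a : T -> C := fun x => (x == a)%:R.

Lemma delta_out a x : ~ [set a] x -> delta a x = 0.
Proof. by rewrite /delta => /eqP/negPf ->. Qed.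

Lemma delta_L2 a : inL2 (delta a).
Proof. exact: inL2_fin (finite_set1 a) (@delta_out a). Qed.

Lemma conjc_delta a x : conjc (delta a x) = delta a x.
Proof. by rewrite /delta; case: eqP => _; apply: complexP => //=; rewrite oppr0. Qed.

Lemma inner_delta u a : inner u (delta a) = u a * (mu R a)%:C.
Proof.
rewrite /inner (integral_mu_fin (finite_set1 a)) => [|x xa].
  by rewrite fsbig_set1 [X in _ * X * _]conjc_delta /delta eqxx mulr1.
by rewrite delta_out// [X in _ * X](conjc0 R) mulr0.
Qed.

Variable eps : T -> C.

(** The Hilbert space adjoint of [nabla_eps eps]. *)
Definition nabla_eps_adj f : T -> C := fun y => conjc (eps y) * f (parent y).

Lemma nabla_eps_adj_fin (A : set T) f : finite_set A -> (forall x, ~ A x -> f x = 0) ->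
  exists B : set T, finite_set B /\ forall y, ~ B y -> nabla_eps_adj f y = 0.
Proof.
move=> fA fA0; exists (\bigcup_(x in A) succs x); split.
  by apply: bigcup_finite => // x _; exact: succs_finite.
move=> y yB; rewrite /nabla_eps_adj fA0 ?mulr0// => Ay; apply: yB.
by exists (parent y) => //; apply/succsE.
Qed.

Lemma nabla_eps_adj_delta u a :
  inner (nabla_eps eps u) (delta a) = inner u (nabla_eps_adj (delta a)).
Proof.
have q0 : q%:R != 0 :> R by rewrite pnatr_eq0; lia.
rewrite inner_delta /inner (integral_mu_fin (succs_finite a)); last first.
  move=> y ya; rewrite /nabla_eps_adj delta_out; last by move=> /succsE.
  by rewrite mulr0 [X in _ * X](conjc0 R) mulr0.
rewrite /nabla_eps !fsbig_finite; try exact: succs_finite.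
rewrite mulr_sumr mulr_suml; apply: eq_big_seq => y.
rewrite in_fset_set; last exact: succs_finite.
move=> /set_mem/succsE ya; rewrite /nabla_eps_adj ya.
rewrite [X in _ = _ * X * _](_ : _ = eps y); last first.
  by rewrite /delta eqxx mulr1; exact: conjcK.
rewrite -ya mu_parent// rmorphM (rmorph_nat (real_complex R)).
field.
by rewrite pnatr_eq0; lia.
Qed.

End FiniteSupport.

(** * A dipole and its image *)

Section Atom.
Context (R : realType) (q : nat) (hq : (2 <= q)%N) (T : flow_tree q).
Local Notation C := R[i].
Local Notation normc := ComplexField.Normc.normc.
Variables (x0 z : T).
Hypotheses (x0z : x0 <> z) (pz : parent z = parent x0).

Definition dipole : T -> C := fun x => -1 * delta R z x + delta R x0 x.

Lemma dipole_out x : ~ [set x0; z] x -> dipole x = 0.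
Proof.
move=> xN; rewrite /dipole !delta_out ?mulr0 ?addr0// => xE; apply: xN; first by left.
by right.
Qed.

Lemma dipole_fin : finite_set [set x0; z].
Proof. by rewrite finite_setU; split; exact: finite_set1. Qed.

Lemma dipole_x0 : dipole x0 = 1.
Proof. by rewrite /dipole /delta eqxx (introF eqP x0z) mulr0 add0r. Qed.

Lemma dipole_z : dipole z = -1.
Proof.
by rewrite /dipole /delta eqxx (introF eqP (nesym x0z)) mulr1 addr0.
Qed.

Lemma normc_dipole x : normc (dipole x) <= 1.
Proof.
have [->|/eqP xx0] := eqVneq x x0.
  by rewrite dipole_x0 ComplexField.Normc.normc1.
have [->|/eqP xz] := eqVneq x z.
  by rewrite dipole_z /= oppr0 expr0n/= addr0 sqrrN expr1n sqrtr1.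
by rewrite dipole_out ?ComplexField.Normc.normc0// => -[].
Qed.

Lemma dipole_L2 : inL2 dipole.
Proof. exact (inL2_fin hq dipole_fin (@dipole_out)). Qed.

Lemma dipole_L1 : inL1 dipole.
Proof. exact (inL1_fin hq dipole_fin (@dipole_out)). Qed.

Lemma level_z : level z = level x0.
Proof. by have := level_parent z; rewrite pz level_parent => /addIr. Qed.

Lemma integral_dipole : integral_mu dipole = 0.
Proof.
have -> := integral_mu_fin dipole_fin (@dipole_out).
rewrite fsbigU0; [|exact: finite_set1|exact: finite_set1|by move=> y [-> /x0z]].
rewrite !fsbig_set1 dipole_x0 dipole_z /mu level_z mul1r mulN1r; exact: subrr.
Qed.

(** The smallest trapezoids, through which a difference of two siblings is a
    multiple of an atom. *)
Lemma trapezoid_succs (x : T) : trapezoid x 1 2 = succs x.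
Proof.
apply/seteqP; split => y.
  case=> xy l1 l2; have ly : level y = level x - 1 by lia.
  by split => //; apply: dist1_adj; move: xy; rewrite /above ly; lia.
case=> xy ly; rewrite /trapezoid/= ly; split; [|lia|lia].
by rewrite /above (dist_adj xy) ly; lia.
Qed.

Lemma real_complex_mulV (r : R) : r != 0 -> r%:C * (r^-1)%:C = 1.
Proof.
move=> r0; apply: complexP; rewrite ?cReM ?cImM /=.
  by rewrite mulr0 subr0 divff.
by rewrite mulr0 mul0r addr0.
Qed.

Lemma dipole_atom : exists2 N, 0 < N & is_atom (fun x => (N^-1)%:C * dipole x).
Proof.
pose F := succs (parent x0).
have fF : finite_set F by exact: succs_finite.
have subF : [set x0; z] `<=` F by move=> x [] ->; apply/succsE.
have muF : mu_set R F = (\sum_(y \in F) mu R y)%:E.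
  by rewrite /mu_set esum_fset ?fsumEFin// => y _; rewrite lee_fin ltW// mu_gt0.
have N0 : 0 < \sum_(y \in F) mu R y.
  have : ((mu R x0)%:E <= mu_set R F)%E.
    rewrite /mu_set; apply: esum_ge; exists [set x0]; last by rewrite fsbig_set1.
    by split; [exact: finite_set1|move=> y ->; apply: subF; left].
  by rewrite muF lee_fin; apply: lt_le_trans; exact: mu_gt0.
exists (\sum_(y \in F) mu R y); first exact: N0.
exists F; rewrite muF; move: (\sum_(y \in F) mu R y) N0 => N N0 {muF}.
have NV0 : 0 <= N^-1 by rewrite invr_ge0 ltW.
split.
- right; exists (parent x0), 1%N, 2%N; split => //.
  by rewrite trapezoid_succs.
- by move=> x Fx; rewrite dipole_out ?mulr0// => /subF.
- have z1 : inL1 (fun _ : T => 0 : C) by exact (inL1_fin hq (finite_set0 T) (fun _ _ => erefl)).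
  rewrite (_ : (fun x => _) = fun x => (N^-1)%:C * dipole x + 0); last first.
    by apply/funext => x; rewrite addr0.
  rewrite (integral_mu_lin hq _ dipole_L1 z1) integral_dipole mulr0 add0r.
  by rewrite (integral_mu_fin (finite_set0 T))// fsbig_set0.
- move=> x; rewrite ComplexField.Normc.normcM.
  rewrite [normc _%:C]/= expr0n/= addr0 sqrtr_sqr ger0_norm//.
  by rewrite -[leRHS]mulr1 ler_wpM2l ?normc_dipole.
Qed.

Lemma dipole_H1 : inH1 dipole.
Proof.
split; first exact: dipole_L1.
have [N N0 aN] := dipole_atom.
pose lam (j : nat) : C := if j is 0%N then N%:C else 0.
have La x : lam 0 * ((N^-1)%:C * dipole x) = dipole x.
  by rewrite mulrA [X in X * _]real_complex_mulV ?mul1r// gt_eqF.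
have normlam0 : normc (lam 0) = N.
  by rewrite [LHS]/= expr0n/= addr0 sqrtr_sqr ger0_norm// ltW.
exists lam, (fun=> fun x => (N^-1)%:C * dipole x); split.
- by move=> _; exact: aN.
- apply: (@le_lt_trans _ _ N%:E); last by rewrite ltry.
  apply: lime_le; first by apply: is_cvg_nneseries => n _ _; rewrite lee_fin normc_ge0.
  apply: nearW => -[|K]; first by rewrite big_geq// lee_fin ltW.
  rewrite big_nat_recl// big1 ?adde0 ?normlam0// => i _.
  by rewrite (ComplexField.Normc.normc0 R).
- apply: cvg_near_cst; exists 1%N => // -[//|n] _.
  rewrite /norm1 esum1// => x _.
  rewrite big_nat_recl// La big1 ?addr0 ?subrr; last by move=> i _; rewrite mul0r.
  by rewrite ComplexField.Normc.normc0 mul0r.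
Qed.

End Atom.

Section Counterexample.
Context (R : realType) (q : nat) (hq : (2 <= q)%N) (T : flow_tree q).
Local Notation C := R[i].
Local Notation normc := ComplexField.Normc.normc.
Local Notation Re := complex.Re.
Variables (eps : T -> C) (M : R).
Hypotheses (epsM : forall x, normc (eps x) <= M)
  (eps0 : forall x : T, \sum_(y \in succs x) eps y = 0).
Variables (x0 z x1 : T).
Hypotheses (x0z : x0 <> z) (pz : parent z = parent x0)
  (px1 : parent x1 = x0) (epsx1 : eps x1 <> 0).
Local Notation f := (dipole R x0 z).
Local Notation w := (nabla_eps_adj eps f).

Lemma level_source y : w y <> 0 -> level y = level x0 - 1.
Proof.
move=> wy; have [py|py] := pselect ([set x0; z] (parent y)).
  have lz := level_z pz.
  by have := level_parent y; case: py => ->; rewrite ?lz; lia.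
by move: wy; rewrite /nabla_eps_adj dipole_out// mulr0.
Qed.

Lemma sum_succs_source x : \sum_(y \in succs x) w y = 0.
Proof.
rewrite (eq_fsbigr (fun y => conjc (eps y) * f x)); last first.
  by move=> y /set_mem/succsE yx; rewrite /nabla_eps_adj yx.
have := eps0 x; rewrite !fsbig_finite; try exact: succs_finite.
rewrite -mulr_suml => /(congr1 (@conjc R)).
rewrite (big_morph (@conjc R) (@conjcD R) (conjc0 R)) => ->.
by rewrite (conjc0 R) mul0r.
Qed.

Lemma M_ge0 : 0 <= M.
Proof. exact: le_trans (normc_ge0 _) (epsM x0). Qed.

Lemma normc_source y : normc (w y) <= M.
Proof.
rewrite /nabla_eps_adj ComplexField.Normc.normcM normc_conj -[leRHS]mulr1.
by rewrite ler_pM ?normc_ge0// normc_dipole.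
Qed.

Lemma source_L2 : inL2 w.
Proof.
have [B [fB B0]] := nabla_eps_adj_fin eps (dipole_fin x0 z) (@dipole_out R q T x0 z).
exact (inL2_fin hq fB B0).
Qed.

Lemma source_pos : 0 < Re (inner w w).
Proof.
rewrite lt_neqAle inner_ge0// ?andbT; last exact: source_L2.
apply/eqP => /esym /(inner_eq0 hq source_L2) /(congr1 (fun k => k x1)).
rewrite /nabla_eps_adj px1 dipole_x0// mulr1 => e0.
by apply: epsx1; rewrite -[LHS]conjcK e0 (conjc0 R).
Qed.

Lemma pairing_source u : inL2 u -> inL2 (nabla_eps eps u) ->
  inner (nabla_eps eps u) f = inner u w.
Proof.
move=> u2 nu2; have d2 a := delta_L2 R hq (T := T) a.
have D2 a : inL2 (nabla_eps_adj eps (delta R a)).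
  have [B [fB B0]] := nabla_eps_adj_fin eps (finite_set1 a) (@delta_out R q T a).
  exact (inL2_fin hq fB B0).
have -> : w = (fun x => -1 * nabla_eps_adj eps (delta R z) x + nabla_eps_adj eps (delta R x0) x).
  by apply/funext => y; rewrite /nabla_eps_adj /dipole; ring.
rewrite /dipole (innerDr hq (inL2Z hq (-1) (d2 z)) (d2 x0) nu2).
rewrite (innerDr hq (inL2Z hq (-1) (D2 z)) (D2 x0) u2).
by rewrite (innerZr hq (-1) (d2 z) nu2) (innerZr hq (-1) (D2 z) u2) !nabla_eps_adj_delta.
Qed.

Variables (A B : (T -> C) -> (T -> C)).
Hypotheses (HA : riesz_transform eps A) (HB : adjoint_of A B).

(** Let [v s] be the geometric extension of [w] with ratio [1 - s], so that
    [(s^2 + 2 (1 - s) L) (v s) = w]. It agrees with [w] where [w] lives, and it is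
    bounded by [M] whatever [s]. Hence [<w, v s>] does not depend on [s], and if
    [B f] were integrable then [<Q (v s), w> = <A (v s), f> = <v s, B f>] would be
    bounded in [s]: the spectral measure of [w] would be the impossible one. *)
Lemma adjoint_dipole_not_L1 : ~ inL1 (B f).
Proof.
move=> Bf1.
case: HA => -[A2 _ _] [E [Q [EL EQ AQ]]].
case: HB => -[B2 _ _] adjAB.
have f2 : inL2 f := dipole_L2 R hq x0 z.
have w2 := source_L2; have M0 := M_ge0.
have L_ge0 (g : T -> C) : inL2 g -> 0 <= Re (inner (laplacian g) g).
  by move=> g2; apply: laplacian_ge0 => //; exact (op_L2 EL g2).
pose L := level x0 - 1.
pose v s := geometric w L (1 - s).
have r01 (s : R) : 0 < s < 1 -> 0 <= 1 - s < 1 by move=> /andP[? ?]; apply/andP; split; lra.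
have v2 (s : R) : 0 < s < 1 -> inL2 (v s).
  by move=> s01; apply: geometric_L2 => //; exact: r01.
have gv (s : R) : affine_op (@laplacian R q T) (s ^+ 2) (2 * (1 - s)) (v s) = w.
  apply/funext => x; rewrite -[RHS](geometric_resolvent hq (1 - s) level_source sum_succs_source x).
  by rewrite /affine_op; congr ((_ ^+ 2)%:C * _ + _); ring.
have vM (s : R) : 0 < s < 1 -> forall x, normc (v s x) <= M.
  move=> /r01 /andP[r0 r1]; apply: normc_geometric => //; last exact: normc_source.
  by rewrite r0 ltW.
have s2 (s : R) : 0 < s < 1 -> 0 < s ^+ 2 by case/andP => s0 _; rewrite exprn_gt0.
have s1 (s : R) : 0 < s < 1 -> 0 <= 2 * (1 - s) by case/andP => _ ?; lra.
have H1 (s : R) : 0 < s < 1 ->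
    (\int[smeas E w]_t ((resolvent_symbol s t)^-1)%:E = (Re (inner w w))%:E)%E.
  move=> s01; have := inner_resolvent hq EL L_ge0 (ltW (s2 s s01)) (s1 s s01) (s2 s s01) (v2 s s01).
  rewrite gv => ->; congr (Re _)%:E; congr integral_mu; apply/funext => x.
  exact: mul_conj_geometric level_source x.
have Dw : spectral_dom E (@inv_sqrt R) w.
  split => //; apply: (@le_lt_trans _ _ (3 * Re (inner w w))%:E); last by rewrite ltry.
  have lim : (\int[smeas E w]_t (1 / Num.max t 0)%:E <= (3 * Re (inner w w))%:E)%E.
    apply: (integral_le_limit (psi := fun=> 1)) => // s s01.
    rewrite -(H1 s s01) le_eqVlt; apply/orP; left; apply/eqP.
    by apply: eq_integral => t _; rewrite mul1r.
  apply: le_trans lim; rewrite le_eqVlt; apply/orP; left; apply/eqP.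
  by apply: eq_integral => t _; rewrite inv_sqrt_sqr mul1r.
pose K := M * fine (norm1 (B f)).
have H2 (s : R) : 0 < s < 1 ->
    (\int[smeas E w]_t (inv_sqrt t / resolvent_symbol s t)%:E <= K%:E)%E.
  move=> s01.
  have Dv : spectral_dom E (@inv_sqrt R) (v s).
    by apply: (spectral_dom_resolvent hq EL L_ge0 (s2 s s01) (s1 s s01) (v2 s s01)); rewrite gv.
  have := inner_inv_sqrt_resolvent hq EL L_ge0 EQ (s2 s s01) (s1 s s01) (v2 s s01).
  rewrite gv => /(_ Dw) ->; rewrite lee_fin.
  have Av := AQ _ Dv.
  have nQ2 : inL2 (nabla_eps eps (Q (v s))) by rewrite -Av; apply: A2; exact: v2.
  have Q2 : inL2 (Q (v s)) by case: EQ => + _ _; apply.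
  rewrite -pairing_source// -Av adjAB//; last exact: v2.
  have vB1 := inL2_mul hq (v2 s s01) (B2 f f2).
  apply: le_trans (ler_norm _) _; apply: le_trans (Re_integral_mu_le hq vB1) _.
  have n0 : (0 <= norm1 (B f))%E.
    by apply: esum_ge0 => x _; rewrite lee_fin mulr_ge0 ?normc_ge0// ltW ?mu_gt0.
  have le1 : (norm1 (fun x => (v s x * conjc (B f x))%R) <= M%:E * norm1 (B f))%E.
    rewrite /norm1 -esumZl//; last by move=> x; rewrite mulr_ge0 ?normc_ge0// ltW ?mu_gt0.
    apply: le_esum => x _; rewrite lee_fin ComplexField.Normc.normcM normc_conj mulrA.
    rewrite ler_wpM2r ?(ltW (mu_gt0 _ _ _))// ler_wpM2r ?normc_ge0//; exact: vM.
  have nE : norm1 (B f) = (fine (norm1 (B f)))%:E by rewrite fineK// ge0_fin_numE.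
  rewrite -lee_fin fineK; first by rewrite /K EFinM -nE.
  by rewrite ge0_fin_numE//; apply: esum_ge0 => x _; rewrite lee_fin mulr_ge0 ?normc_ge0// ltW ?mu_gt0.
exact: no_spectral_measure source_pos H1 H2.
Qed.

End Counterexample.

Theorem proposition5p6 (R : realType) (q : nat) (hq : (2 <= q)%N)
    (T : flow_tree q) (eps : T -> R[i])
    (eps_bounded : bounded_weight eps)
    (eps_mean0 : forall x : T, \sum_(y \in succs x) eps y = 0)
    (eps_neq0 : exists x : T, eps x <> 0)
    (Reps : (T -> R[i]) -> (T -> R[i])) (HReps : riesz_transform eps Reps)
    (Radj : (T -> R[i]) -> (T -> R[i])) (HRadj : adjoint_of Reps Radj) :
  ~ (forall f : T -> R[i], inH1 f -> inL2 f -> inL1 (Radj f)).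
Proof.
case: eps_neq0 => x1 epsx1; case: eps_bounded => M epsM; pose x0 := parent x1.
have [z zx0 pz] : exists2 z, x0 <> z & parent z = parent x0.
  apply: contrapT => noz; have := succs_card (parent x0).
  rewrite (_ : succs (parent x0) = [set x0]) ?fset_set1 ?finmap.cardfs1 => [q1|].
    by move: hq; rewrite -q1.
  apply/seteqP; split => y; rewrite succsE; last by move->.
  by move=> py; apply: contrapT => yx; apply: noz; exists y => // x0y; apply: yx.
move=> L1; apply: (adjoint_dipole_not_L1 hq epsM eps_mean0 zx0 pz (erefl x0) epsx1 HReps HRadj).
by apply: L1; [exact: dipole_H1|exact: dipole_L2].
Qed.
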